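(* Assume $m\ge 2$ and let $Y=\{x\in\mathbb{R}^n:\phi(x)=0\}$. For every $x\in\mathbb{R}^n$ the limit $\lim_{s\to+\infty}F(s,x)$ exists. Define $U:[0,1]\times\mathbb{R}^n\to\mathbb{R}^n$ by $U(t,x)=F\big(\tfrac{t}{1-t},x\big)$ for $0\le t<1$ and $U(1,x)=\lim_{s\to+\infty}F(s,x)$. Then $U$ is continuous, $U(0,x)=x$ for all $x\in\mathbb{R}^n$, $U(t,y)=y$ for all $t\in[0,1]$ and $y\in Y$, and $U(1,\mathbb{R}^n)=Y$; i.e. $U$ is a strong deformation retraction of $\mathbb{R}^n$ onto $Y$.
   Context: Let $n\ge 1$ and let $\phi\in\mathbb{R}[x_1,\dots,x_n]$ be a homogeneous polynomial of degree $m$ with $\phi(x)\ge 0$ for all $x\in\mathbb{R}^n$. Use the standard inner product on $\mathbb{R}^n$ with Euclidean gradient $\nabla\phi$. $F(t,x)$ denotes the solution of $\frac{d}{dt}F(t,x)=-\nabla\phi(F(t,x))$, $F(0,x)=x$, defined for all $t\ge0$. *)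

(* Defs.v *)
From mathcomp Require Import ssreflect ssrfun ssrbool eqtype ssrnat seq fintype bigop.
From Stdlib Require Import Reals.
Open Scope R_scope.

Definition vec (n : nat) := 'I_n -> R.

Definition vsub {n} (x y : vec n) : vec n := fun i => x i - y i.

Definition vnorm {n} (x : vec n) : R := sqrt (\big[Rplus/0]_(i < n) (x i ^ 2)).

Definition monomial {n} (e : 'I_n -> nat) (x : vec n) : R :=
  \big[Rmult/1]_(i < n) (x i ^ e i).

Definition is_homog_poly (n m : nat) (phi : vec n -> R) : Prop :=
  exists l : seq (R * ('I_n -> nat)),
    (forall p, List.In p l -> (\sum_(i < n) p.2 i)%N = m) /\
    (forall x, phi x = \big[Rplus/0]_(p <- l) (p.1 * monomial p.2 x)).

Definition vshift {n} (x : vec n) (i : 'I_n) (s : R) : vec n :=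
  fun j => if j == i then x j + s else x j.

Definition is_gradient {n} (phi : vec n -> R) (g : vec n -> vec n) : Prop :=
  forall x i, derivable_pt_lim (fun s => phi (vshift x i s)) 0 (g x i).

Definition is_neg_grad_flow {n} (g : vec n -> vec n) (F : R -> vec n -> vec n) : Prop :=
  (forall x, F 0 x = x) /\
  (forall x i t, 0 < t -> derivable_pt_lim (fun s => F s x i) t (- g (F t x) i)) /\
  (forall x i eps, 0 < eps -> exists d, 0 < d /\
       forall s, 0 <= s < d -> Rabs (F s x i - x i) < eps).

Definition tends_to_infty {n} (f : R -> vec n) (L : vec n) : Prop :=
  forall eps, 0 < eps -> exists M, forall s, M <= s -> vnorm (vsub (f s) L) < eps.

Definition Uhom {n} (F : R -> vec n -> vec n) (Finf : vec n -> vec n) (t : R) (x : vec n)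
  : vec n :=
  if Rlt_dec t 1 then F (t / (1 - t)) x else Finf x.

Definition continuous_on_I_Rn {n} (U : R -> vec n -> vec n) : Prop :=
  forall t x, 0 <= t <= 1 -> forall eps, 0 < eps -> exists d, 0 < d /\
    forall t' x', 0 <= t' <= 1 -> Rabs (t' - t) < d -> vnorm (vsub x' x) < d ->
      vnorm (vsub (U t' x') (U t x)) < eps.

(* Main.v *)
(** By Euler's identity |F| does not increase and phi(F) tends to 0, uniformly on
    bounded sets, so everything rests on one estimate: a trajectory that starts in a
    fixed ball at a small value of phi is short.  This is Kurdyka's talweg argument.
    On each level phi = c inside the ball choose the point gamma(c) that minimizes
    |grad phi|, ties being broken lexicographically, so that gamma is semialgebraic;
    its coordinates are then monotone near c = 0 and gamma has finite length V.  On the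
    level c a trajectory moves by |dx| = |dc| / |grad phi(x)| <=
    |dc| / |grad phi(gamma(c))| <= |dV|, and V(c) has a limit at c = 0.
    Semialgebraic monotonicity comes from quantifier elimination over R: no derivative
    of gamma is needed, as the comparison of gamma_i(c) and gamma_i(c') is a definable
    relation, transitive together with its negation.
    The estimate makes the flow uniformly Cauchy on bounded sets, which with continuous
    dependence on the initial point gives the retraction. *)
Require Import Defs.
From Stdlib Require Import Reals Lra Lia Classical ClassicalEpsilon FunctionalExtensionality.
From mathcomp Require Import ssreflect ssrfun ssrbool eqtype ssrnat seq fintype bigop.
From mathcomp Require Import order ssralg poly ssrnum interval.
From mathcomp Require Import polyrcf.
From mathcomp Require Import ordered_qelim.
From mathcomp Require qe_rcf.
From mathcomp Require Import Rstruct.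
Open Scope R_scope.

(** * Definable sets *)

(** The chosen curve [gamma] is not known to be continuous, so neither its length nor that of a
    trajectory is obtained by integration. Both are replaced by [chain], an induction along an
    interval: a transitive relation that holds locally on both sides of every point holds between
    the endpoints. It is applied to the comparison of coordinates of [gamma], and again to the
    relation that bounds a chord of a trajectory by a multiple of the drop of V. Breaking ties makes
    the set of minimizers on a level a single point, so a formula that quantifies over all
    minimizers speaks of [gamma] itself, although [gamma] comes from the axiom of choice. Once every
    coordinate is monotone, the l1 norm of a chord of [gamma] is exactly the increment of a signed
    sum of coordinates. This sum is V, and it is the reason for working with the l1 norm.
    Homogeneity enters through Euler's identity: the gradient does not vanish where phi > 0, and on
    a ball it is bounded below by a multiple of phi, so the decay time depends only on the ball. *)

Definition upd (e : nat -> R) (i : nat) (x : R) : nat -> R :=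
  fun j => if j == i then x else e j.

(** Environments of formulas are finite lists. Read through [nth 0] they become total sequences, so
    a variable beyond the end of the list has the value 0. *)
Definition definable (P : (nat -> R) -> Prop) :=
  exists f : ord.formula R, forall e : seq R, ord.holds e f <-> P (nth 0 e).

Definition definable_fun (p : (nat -> R) -> R) :=
  exists t : GRing.term R, forall e : seq R, GRing.eval e t = p (nth 0 e).

Lemma nth_upd (e : seq R) i x : nth 0 (set_nth 0 e i x) = upd (nth 0 e) i x.
Proof. by apply: functional_extensionality => j; rewrite nth_set_nth. Qed.

Lemma definable_ext P Q :
  (forall e, P e <-> Q e) -> definable P -> definable Q.
Proof. by move=> PQ [f Hf]; exists f => e; rewrite Hf; apply: PQ. Qed.

Lemma definable_and P Q :
  definable P -> definable Q -> definable (fun e => P e /\ Q e).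
Proof. by move=> [f Hf] [h Hh]; exists (ord.And f h) => e /=; rewrite Hf Hh. Qed.

Lemma definable_imp P Q :
  definable P -> definable Q -> definable (fun e => P e -> Q e).
Proof. by move=> [f Hf] [h Hh]; exists (ord.Implies f h) => e /=; rewrite Hf Hh. Qed.

Lemma definable_not P : definable P -> definable (fun e => ~ P e).
Proof. by move=> [f Hf]; exists (ord.Not f) => e /=; rewrite Hf. Qed.

Lemma definable_ex P i :
  definable P -> definable (fun e => exists x, P (upd e i x)).
Proof.
move=> [f Hf]; exists (ord.Exists i f) => e /=.
by split=> -[x Hx]; exists x; move: Hx; rewrite Hf nth_upd.
Qed.

Lemma definable_all P i :
  definable P -> definable (fun e => forall x, P (upd e i x)).
Proof.
move=> [f Hf]; exists (ord.Forall i f) => e /=.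
by split=> H x; move: (H x); rewrite Hf nth_upd.
Qed.

Lemma definable_fun_var i : definable_fun (fun e => e i).
Proof. by exists (GRing.Var _ i). Qed.

Lemma definable_fun_const c : definable_fun (fun=> c).
Proof. by exists (GRing.Const c). Qed.

Lemma definable_fun_add p q :
  definable_fun p -> definable_fun q -> definable_fun (fun e => p e + q e).
Proof. by move=> [t Ht] [u Hu]; exists (GRing.Add t u) => e /=; rewrite Ht Hu. Qed.

Lemma definable_fun_mul p q :
  definable_fun p -> definable_fun q -> definable_fun (fun e => p e * q e).
Proof. by move=> [t Ht] [u Hu]; exists (GRing.Mul t u) => e /=; rewrite Ht Hu. Qed.

Lemma definable_le p q :
  definable_fun p -> definable_fun q -> definable (fun e => p e <= q e).
Proof.
move=> [t Ht] [u Hu]; exists (ord.Le t u) => e /=; rewrite Ht Hu.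
by split=> /RleP.
Qed.

Lemma definable_eq p q :
  definable_fun p -> definable_fun q -> definable (fun e => p e = q e).
Proof. by move=> [t Ht] [u Hu]; exists (ord.Equal t u) => e /=; rewrite Ht Hu. Qed.

Lemma definable_lt p q :
  definable_fun p -> definable_fun q -> definable (fun e => p e < q e).
Proof.
move=> [t Ht] [u Hu]; exists (ord.Lt t u) => e /=; rewrite Ht Hu.
by split=> /RltP.
Qed.

(** * Tame subsets of the line *)

Definition right_germ (A : R -> Prop) a :=
  exists d, 0 < d /\ forall x, a < x < a + d -> A x.

Definition left_germ (A : R -> Prop) a :=
  exists d, 0 < d /\ forall x, a - d < x < a -> A x.

(** A local form of o-minimality: the boundary of [A] is locally finite. Nothing is asked at
    infinity, since only one-sided germs at finite points are used. *)
Definition tame (A : R -> Prop) := forall a,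
  (right_germ A a \/ right_germ (fun x => ~ A x) a) /\
  (left_germ A a \/ left_germ (fun x => ~ A x) a).

Lemma tame_ext A B : (forall x, A x <-> B x) -> tame A -> tame B.
Proof.
move=> AB tA a; have [tr tl] := tA a; split.
- case: tr => -[d [d0 H]]; [left|right]; exists d; split => // x /H; rewrite AB //.
- case: tl => -[d [d0 H]]; [left|right]; exists d; split => // x /H; rewrite AB //.
Qed.

Lemma tame_not A : tame A -> tame (fun x => ~ A x).
Proof.
move=> tA a; have [tr tl] := tA a; split.
- case: tr => -[d [d0 H]]; [right|left]; exists d; split => // x /H; tauto.
- case: tl => -[d [d0 H]]; [right|left]; exists d; split => // x /H; tauto.
Qed.

Lemma right_germ_and A B a :
  right_germ A a -> right_germ B a -> right_germ (fun x => A x /\ B x) a.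
Proof.
move=> [d [d0 H]] [c [c0 K]]; exists (Rmin d c); split; first exact: Rmin_pos.
by move=> x hx; have := Rmin_l d c; have := Rmin_r d c; split; [apply: H|apply: K]; lra.
Qed.

Lemma left_germ_and A B a :
  left_germ A a -> left_germ B a -> left_germ (fun x => A x /\ B x) a.
Proof.
move=> [d [d0 H]] [c [c0 K]]; exists (Rmin d c); split; first exact: Rmin_pos.
by move=> x hx; have := Rmin_l d c; have := Rmin_r d c; split; [apply: H|apply: K]; lra.
Qed.

Lemma right_germ_imp (A B : R -> Prop) a :
  (forall x, A x -> B x) -> right_germ A a -> right_germ B a.
Proof. by move=> AB [d [d0 H]]; exists d; split => // x /H /AB. Qed.

Lemma left_germ_imp (A B : R -> Prop) a :
  (forall x, A x -> B x) -> left_germ A a -> left_germ B a.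
Proof. by move=> AB [d [d0 H]]; exists d; split => // x /H /AB. Qed.

Lemma tame_and A B : tame A -> tame B -> tame (fun x => A x /\ B x).
Proof.
move=> tA tB a; have [Ar Al] := tA a; have [Br Bl] := tB a; split.
- case: Ar => Ar; last by right; apply: right_germ_imp Ar; tauto.
  case: Br => Br; last by right; apply: right_germ_imp Br; tauto.
  by left; apply: right_germ_and.
- case: Al => Al; last by right; apply: left_germ_imp Al; tauto.
  case: Bl => Bl; last by right; apply: left_germ_imp Bl; tauto.
  by left; apply: left_germ_and.
Qed.

Lemma tame_cst (P : Prop) : tame (fun=> P).
Proof.
by move=> a; case: (classic P) => HP; split; [left|left|right|right]; exists 1; split=> //; lra.
Qed.

Section SignTame.
Import Order.TTheory GRing.Theory Num.Theory.

(** A nonzero polynomial has no root in some one-sided neighbourhood of [a], so its sign there is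
    that at a witness [m], which also supplies the radius of the germ. *)
Lemma tame_sgr (p : {poly R}) (s : R) : tame (fun x => Num.sg p.[x]%R = s).
Proof.
move=> a; case: (eqVneq p 0%R) => [->|p0].
  have H : forall x : R, Num.sg (0 : {poly R}).[x]%R = 0%R by move=> x; rewrite horner0 sgr0.
  apply: (tame_ext _ _ _ (tame_cst (0%R = s)) a) => x; by rewrite H.
split.
- have a1 : a < a + 1 by lra.
  have [m hm] := @neighpr_wit R p a (Rplus a 1) (introT RltP a1) p0.
  have /RltP am : (a < m)%R by move: hm; rewrite inE /= => /andP[].
  have H x : a < x < a + (m - a) -> Num.sg p.[x]%R = Num.sg p.[m]%R.
    move=> xm; apply: (sgr_neighpr_same (x := a) (b := (Rplus a 1))) => //.
    move: hm; rewrite /neighpr !in_itv /= => /andP[_ mn].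
    apply/andP; split; first by apply/RltP; lra.
    by apply: lt_trans mn; apply/RltP; lra.
  by case: (classic (Num.sg p.[m]%R = s)) => E; [left|right]; exists (m - a); split;
    try lra; move=> x /H ->.
- have a1 : a - 1 < a by lra.
  have [m hm] := @neighpl_wit R p (Rminus a 1) a (introT RltP a1) p0.
  have /RltP am : (m < a)%R by move: hm; rewrite !in_itv /= => /andP[].
  have H x : a - (a - m) < x < a -> Num.sg p.[x]%R = Num.sg p.[m]%R.
    move=> xm; apply: (sgr_neighpl_same (x := a) (a := (Rminus a 1))) => //.
    move: hm; rewrite /neighpl !in_itv /= => /andP[mn _].
    apply/andP; split; last by apply/RltP; lra.
    by apply: lt_trans mn _; apply/RltP; lra.
  by case: (classic (Num.sg p.[m]%R = s)) => E; [left|right]; exists (a - m); split;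
    try lra; move=> x /H ->.
Qed.

Lemma eval_polyE (t : GRing.term R) (i : nat) (e : seq R) : GRing.rterm t ->
  exists p : {poly R}, forall x, GRing.eval (set_nth 0 e i x) t = p.[x]%R.
Proof.
move=> rt; exists (qe_rcf.eval_poly e (qe_rcf.abstrX i (qe_rcf.to_rterm t))) => x.
by rewrite qe_rcf.abstrXP qe_rcf.evalE qe_rcf.to_rtermE.
Qed.

(** With all variables but one fixed, an atom compares two univariate polynomials and is a sign
    condition on their difference. Disjunction and implication are reduced to conjunction and
    negation. *)
Lemma tame_qf (f : ord.formula R) (i : nat) (e : seq R) :
  ord.qf_form f -> ord.rformula f -> tame (fun x => ord.qf_eval (set_nth 0 e i x) f).
Proof.
elim: f => //=.
- by move=> b _ _; apply: tame_cst.
- move=> t u _ /andP[/(eval_polyE _ i e)[p Hp] /(eval_polyE _ i e)[q Hq]].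
  apply: (tame_ext _ _ _ (tame_sgr (p - q)%R 0)) => x.
  rewrite Hp Hq hornerD hornerN; split; first by move/eqP; rewrite sgr_eq0 subr_eq0.
  by move=> E; apply/eqP; rewrite sgr_eq0 subr_eq0.
- move=> t u _ /andP[/(eval_polyE _ i e)[p Hp] /(eval_polyE _ i e)[q Hq]].
  apply: (tame_ext _ _ _ (tame_sgr (q - p)%R 1)) => x.
  rewrite Hp Hq hornerD hornerN; split; first by move/eqP; rewrite sgr_cp0 subr_gt0.
  by move=> E; apply/eqP; rewrite sgr_cp0 subr_gt0.
- move=> t u _ /andP[/(eval_polyE _ i e)[p Hp] /(eval_polyE _ i e)[q Hq]].
  apply: (tame_ext _ _ _ (tame_not _ (tame_sgr (p - q)%R 1))) => x.
  rewrite Hp Hq hornerD hornerN leNgt; split.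
    by move=> H; apply/negP => K; apply: H; apply/eqP; rewrite sgr_cp0 subr_gt0.
  by move=> /negP K H; apply: K; rewrite -subr_gt0 -sgr_cp0; apply/eqP.
- move=> f IHf h IHh /andP[qf qh] /andP[rf rh].
  apply: (tame_ext _ _ _ (tame_and _ _ (IHf qf rf) (IHh qh rh))) => x.
  by split=> /andP.
- move=> f IHf h IHh /andP[qf qh] /andP[rf rh].
  apply: (tame_ext _ _ _ (tame_not _ (tame_and _ _ (tame_not _ (IHf qf rf)) (tame_not _ (IHh qh rh))))) => x.
  by split; [move=> H; apply/orP; tauto|move=> /orP; tauto].
- move=> f IHf h IHh /andP[qf qh] /andP[rf rh].
  apply: (tame_ext _ _ _ (tame_not _ (tame_and _ _ (IHf qf rf) (tame_not _ (IHh qh rh))))) => x.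
  by split; [move=> H; apply/implyP; tauto|move=> /implyP; tauto].
- move=> f IHf qf rf.
  apply: (tame_ext _ _ _ (tame_not _ (IHf qf rf))) => x.
  by split; [move=> H; apply/negP|move=> /negP].
Qed.

(* Quantifier elimination over the real closed field R reduces tameness to
   the sign of a univariate polynomial next to a point. *)
Lemma tame_definable (A : R -> Prop) i : definable (fun e => A (e i)) -> tame A.
Proof.
move=> [f Hf].
pose pr := ord.quantifier_elim (fun j bc => qe_rcf.qfr_to_formula (@qe_rcf.wproj R j bc)).
pose h := pr (ord.to_rform f).
have [qh rh] : ord.qf_form h /\ ord.rformula h.
  by apply/andP; apply: ord.quantifier_elim_wf;
    [move=> j bc; exact: qe_rcf.wf_QE_wproj | apply: ord.to_rform_rformula].
apply: (tame_ext _ _ _ (tame_qf h i [::] qh rh)) => x.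
have -> : A x <-> A (nth 0 (set_nth 0 [::] i x) i) by rewrite nth_set_nth /= eqxx.
rewrite -Hf.
have := qe_rcf.rcf_satP (set_nth 0 [::] i x) f.
by rewrite /qe_rcf.rcf_sat /ord.proj_sat => E; split; move/E.
Qed.
End SignTame.

(** * Monotonicity of definable relations *)

(** Let [u] be the supremum of the points related to [s]. The left germ at [u] and transitivity put
    [u] among them; if [u < t], the right germ at [u] would reach further. *)
Lemma chain (Q : R -> R -> Prop) s t : s < t ->
  (forall x y z, s <= x -> x < y -> y < z -> z <= t -> Q x y -> Q y z -> Q x z) ->
  (forall x, s <= x < t -> right_germ (Q x) x) ->
  (forall x, s < x <= t -> left_germ (fun y => Q y x) x) ->
  Q s t.
Proof.
move=> st trQ rQ lQ.
pose E y := s < y <= t /\ Q s y.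
have [d [d0 Hd]] := rQ s ltac:(lra).
have Ey : E (s + Rmin (d / 2) (t - s)).
  have := Rmin_l (d / 2) (t - s); have := Rmin_r (d / 2) (t - s).
  have : 0 < Rmin (d / 2) (t - s) by apply: Rmin_pos; lra.
  by move=> *; split; [lra | apply: Hd; lra].
have [u [ub lub]] : {u | is_lub E u}.
  apply: completeness; last by eexists; exact: Ey.
  by exists t => y [[_ ?] _].
have su : s < u by have := ub _ Ey; case: Ey; lra.
have ut : u <= t by apply: lub => y [[_ ?] _].
have Qsu : Q s u.
  have [c [c0 Hc]] := lQ u ltac:(lra).
  have [y [[[sy yt] Qsy] yu]] : exists y, E y /\ u - c < y.
    apply: NNPP => H; have : u <= u - c; last lra.
    apply: lub => y Hy; apply: Rnot_lt_le => K; apply: H; exists y; split=> //.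
  have yu' := ub y (conj (conj sy yt) Qsy).
  case: (Req_dec y u) => [<- //|ne].
  have yu2 : y < u by case: yu' => // /ne.
  by apply: (trQ _ y) => //; try lra; apply: (Hc y); lra.
case: (Req_dec u t) => [<- //|ne].
have ut' : u < t by case: ut => // /ne.
have [c [c0 Hc]] := rQ u ltac:(lra).
have := Rmin_l (c / 2) (t - u); have := Rmin_r (c / 2) (t - u).
have : 0 < Rmin (c / 2) (t - u) by apply: Rmin_pos; lra.
set z := u + Rmin (c / 2) (t - u) => *.
have : E z by split; [rewrite /z; lra | apply: (trQ _ u) => //; rewrite ?/z; try lra; apply: Hc; lra].
by move/ub; rewrite /z; lra.
Qed.

(** Nested closed intervals, the one at stage [k] avoiding [T k]; their common point is [c]. *)
Lemma Baire_right (T : nat -> R -> Prop) a b : a < b ->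
  (forall k c, a < c < b -> right_germ (fun x => ~ T k x) c) ->
  exists c, a < c < b /\ forall k, ~ T k c.
Proof.
move=> ab HT.
(* The conditions on the old interval are hypotheses of the conclusion, so that the choice function
   is total; an invalid interval gets the dummy [(0, 0)]. *)
have step (kp : nat * (R * R)) : exists q : R * R,
    a <= kp.2.1 -> kp.2.1 < kp.2.2 -> kp.2.2 <= b ->
    kp.2.1 < q.1 /\ q.1 < q.2 /\ q.2 < kp.2.2 /\
    forall x, q.1 <= x <= q.2 -> ~ T kp.1 x.
  case: kp => k [l r] /=.
  case: (classic (a <= l /\ l < r /\ r <= b)) => [[al [lr rb]]|H]; last first.
    by exists (0, 0) => *; case: H.
  have [d [d0 Hd]] := HT k ((l + r) / 2) ltac:(lra).
  have := Rmin_l d ((r - l) / 2); have := Rmin_r d ((r - l) / 2).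
  have : 0 < Rmin d ((r - l) / 2) by apply: Rmin_pos; lra.
  set m := Rmin _ _ => *.
  (* The new interval starts strictly to the right of the midpoint, because the germ there says
     nothing about the midpoint itself. *)
  exists ((l + r) / 2 + m / 3, (l + r) / 2 + m / 2) => /= *; do 3 (split; first lra).
  by move=> x Hx; apply: Hd; lra.
pose nxt kp := proj1_sig (constructive_indefinite_description _ (step kp)).
have nxtP kp := proj2_sig (constructive_indefinite_description _ (step kp)).
pose u := fix u k := if k is k'.+1 then nxt (k', u k') else (a, b).
have uP k : a <= (u k).1 /\ (u k).1 < (u k).2 /\ (u k).2 <= b.
  elim: k => [|k [h1 [h2 h3]]] /=; first lra.
  have := nxtP (k, u k) h1 h2 h3; rewrite -/(nxt (k, u k)) /=; lra.
have uS k : (u k).1 < (u k.+1).1 /\ (u k.+1).1 < (u k.+1).2 /\ (u k.+1).2 < (u k).2 /\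
    forall x, (u k.+1).1 <= x <= (u k.+1).2 -> ~ T k x.
  by have [h1 [h2 h3]] := uP k; exact: (nxtP (k, u k) h1 h2 h3).
have mono j k : (u k).1 <= (u (k + j)%N).1 /\ (u (k + j)%N).2 <= (u k).2.
  elim: j => [|j IH]; first by rewrite addn0; lra.
  by rewrite addnS; have := uS (k + j)%N; lra.
have bnd j k : (u j).1 <= (u k).2.
  have [_ h] := mono j k; have [h' _] := mono k j; rewrite addnC in h'.
  by have := uP (k + j)%N; lra.
have [c [ub lub]] : {c | is_lub (fun x => exists k, x = (u k).1) c}.
  apply: completeness; last by exists (u 0%N).1; exists 0%N.
  by exists b => x [k ->]; exact: (bnd k 0%N).
have cl k : (u k).1 <= c by apply: ub; exists k.
have cr k : c <= (u k).2 by apply: lub => x [j ->]; exact: bnd.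
exists c; split=> [|k].
  by have := cl 1%N; have := cr 1%N; have := uS 0%N; rewrite /= ; lra.
by have [_ [_ [_ H]]] := uS k; apply: H.
Qed.

Lemma definable_right_germ (W : R -> R -> Prop) :
  definable (fun e => W (e 0%N) (e 1%N)) ->
  tame (fun x => right_germ (W x) x).
Proof.
move=> dW; apply: (tame_definable _ 0%N).
have H : definable (fun e => exists d, 0 < d /\ forall y,
    (e 0%N < y -> y < e 0%N + d -> W (e 0%N) y)).
  apply: (definable_ext _ _ _ (definable_ex (fun e => 0 < e 2%N /\ forall y,
    (e 0%N < y -> y < e 0%N + e 2%N -> W (e 0%N) y)) 2%N _)) => //.
  apply: definable_and.
    by apply: definable_lt; [exact: definable_fun_const|exact: definable_fun_var].
  apply: (definable_ext _ _ _ (definable_all (fun e => (e 0%N < e 1%N -> e 1%N < e 0%N + e 2%N -> W (e 0%N) (e 1%N))) 1%N _)) => //.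
  apply: definable_imp; first by apply: definable_lt; exact: definable_fun_var.
  apply: definable_imp => //; apply: definable_lt; first exact: definable_fun_var.
  by apply: definable_fun_add; exact: definable_fun_var.
apply: definable_ext H => e; split=> -[d [d0 H]]; exists d; split=> //.
  by move=> y [y1 y2]; apply: H.
by move=> y y1 y2; apply: H.
Qed.

Lemma definable_left_germ (W : R -> R -> Prop) :
  definable (fun e => W (e 0%N) (e 1%N)) ->
  tame (fun y => left_germ (fun x => W x y) y).
Proof.
move=> dW; apply: (tame_definable _ 1%N).
(* The condition [y - d < x] is put in the form [y < x + d], which compares sums of variables. *)
have H : definable (fun e => exists d, 0 < d /\ forall x,
    (e 1%N < x + d -> x < e 1%N -> W x (e 1%N))).
  apply: (definable_ext _ _ _ (definable_ex (fun e => 0 < e 2%N /\ forall x,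
    (e 1%N < x + e 2%N -> x < e 1%N -> W x (e 1%N))) 2%N _)) => //.
  apply: definable_and.
    by apply: definable_lt; [exact: definable_fun_const|exact: definable_fun_var].
  apply: (definable_ext _ _ _ (definable_all (fun e => (e 1%N < e 0%N + e 2%N -> e 0%N < e 1%N -> W (e 0%N) (e 1%N))) 0%N _)) => //.
  apply: definable_imp.
    apply: definable_lt; first exact: definable_fun_var.
    by apply: definable_fun_add; exact: definable_fun_var.
  by apply: definable_imp => //; apply: definable_lt; exact: definable_fun_var.
apply: definable_ext H => e; split=> -[d [d0 H]]; exists d; split=> //.
  by move=> y [y1 y2]; apply: H; lra.
by move=> y y1 y2; apply: H; lra.
Qed.

(** A real parameter is a constant of the language: variable 0 is bound and equated with it. *)
Lemma tame_section_right (W : R -> R -> Prop) x :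
  definable (fun e => W (e 0%N) (e 1%N)) -> tame (W x).
Proof.
move=> dW; apply: (tame_definable _ 1%N).
apply: (definable_ext _ _ _ (definable_ex (fun e => e 0%N = x /\ W (e 0%N) (e 1%N)) 0%N _)).
  by move=> e; split; [move=> [z [<-]] | move=> H; exists x].
by apply: definable_and => //; apply: definable_eq; [exact: definable_fun_var|exact: definable_fun_const].
Qed.

Lemma tame_section_left (W : R -> R -> Prop) y :
  definable (fun e => W (e 0%N) (e 1%N)) -> tame (fun x => W x y).
Proof.
move=> dW; apply: (tame_definable _ 0%N).
apply: (definable_ext _ _ _ (definable_ex (fun e => e 1%N = y /\ W (e 0%N) (e 1%N)) 1%N _)).
  by move=> e; split; [move=> [z [<-]] | move=> H; exists y].
by apply: definable_and => //; apply: definable_eq; [exact: definable_fun_var|exact: definable_fun_const].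
Qed.

Lemma tame_right_radius (W : R -> R -> Prop) r :
  definable (fun e => W (e 0%N) (e 1%N)) ->
  tame (fun x => forall y, x < y < x + r -> W x y).
Proof.
move=> dW; apply: (tame_definable _ 0%N).
have H : definable (fun e => forall y, e 0%N < y -> y < e 0%N + r -> W (e 0%N) y).
  apply: (definable_ext _ _ _ (definable_all (fun e => (e 0%N < e 1%N -> e 1%N < e 0%N + r -> W (e 0%N) (e 1%N))) 1%N _)) => //.
  apply: definable_imp; first by apply: definable_lt; exact: definable_fun_var.
  apply: definable_imp => //; apply: definable_lt; first exact: definable_fun_var.
  by apply: definable_fun_add; [exact: definable_fun_var|exact: definable_fun_const].
by apply: definable_ext H => e; split=> H y *; apply: H; lra.
Qed.

Lemma tame_left_radius (W : R -> R -> Prop) r :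
  definable (fun e => W (e 0%N) (e 1%N)) ->
  tame (fun y => forall x, y - r < x < y -> W x y).
Proof.
move=> dW; apply: (tame_definable _ 1%N).
have H : definable (fun e => forall x, e 1%N < x + r -> x < e 1%N -> W x (e 1%N)).
  apply: (definable_ext _ _ _ (definable_all (fun e => (e 1%N < e 0%N + r -> e 0%N < e 1%N -> W (e 0%N) (e 1%N))) 0%N _)) => //.
  apply: definable_imp.
    apply: definable_lt; first exact: definable_fun_var.
    by apply: definable_fun_add; [exact: definable_fun_var|exact: definable_fun_const].
  by apply: definable_imp => //; apply: definable_lt; exact: definable_fun_var.
by apply: definable_ext H => e; split=> H y *; apply: H; lra.
Qed.

(* If W holds just to the right and fails just to the left of every point, then
   the points where both happen at scale 1/(k+1) cannot fill an interval, since two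
   close points of such an interval disagree on W; this contradicts Baire. *)
Lemma no_opposite_germs (W : R -> R -> Prop) a b : a < b ->
  definable (fun e => W (e 0%N) (e 1%N)) ->
  (forall c, a < c < b -> right_germ (W c) c) ->
  (forall c, a < c < b -> left_germ (fun x => ~ W x c) c) -> False.
Proof.
move=> ab dW HR HL.
pose T k c := (forall y, c < y < c + / INR k.+1 -> W c y) /\
              (forall x, c - / INR k.+1 < x < c -> ~ W x c).
have ip k : 0 < / INR k.+1 by apply/Rinv_0_lt_compat/lt_0_INR; lia.
have tT k : tame (T k).
  apply: tame_and; first exact: tame_right_radius.
  by apply: (tame_left_radius (fun x y => ~ W x y)); apply: definable_not.
have [c [cab cT]] : exists c, a < c < b /\ forall k, ~ T k c.
  apply: Baire_right => // k c _.
  have [[[d [d0 Hd]]|//] _] := tT k c; exfalso.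
  have := Rmin_l d (/ INR k.+1); have := Rmin_r d (/ INR k.+1).
  have : 0 < Rmin d (/ INR k.+1) by apply: Rmin_pos.
  set m := Rmin _ _ => *.
  (* Both points lie in [T k] and are closer than [1/(k+1)]: the left one asserts [W] of the pair,
     the right one denies it. *)
  have [W1 _] := Hd (c + m / 3) ltac:(lra).
  have [_ W2] := Hd (c + m / 2) ltac:(lra).
  by apply: (W2 (c + m / 3)); [lra | apply: W1; lra].
have [d [d0 Hd]] := HR c cab; have [e [e0 He]] := HL c cab.
have [N [HN N0]] := archimed_cor1 (Rmin d e) (Rmin_pos _ _ d0 e0).
have HN' : / INR N.+1 <= / INR N.
  by apply: Rinv_le_contravar; [exact: lt_0_INR | apply: le_INR; lia].
apply: (cT N); have := Rmin_l d e; have := Rmin_r d e => *.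
by split=> y Hy; [apply: Hd|apply: He]; lra.
Qed.

(** By tameness, near 0 the right germs of [W] are all positive or all negative, and so are the left
    germs. If they agree, [chain] applies to [W] or to its negation, both transitive; if they
    disagree, [no_opposite_germs] gives a contradiction. *)
Lemma definable_dichotomy (W : R -> R -> Prop) b : 0 < b ->
  definable (fun e => W (e 0%N) (e 1%N)) ->
  (forall x y z, 0 < x -> x < y -> y < z -> z < b -> W x y -> W y z -> W x z) ->
  (forall x y z, 0 < x -> x < y -> y < z -> z < b -> ~ W x y -> ~ W y z -> ~ W x z) ->
  exists d, 0 < d <= b /\ ((forall x y, 0 < x -> x < y -> y < d -> W x y) \/
                      (forall x y, 0 < x -> x < y -> y < d -> ~ W x y)).
Proof.
move=> b0 dW tW tNW.
have dNW : definable (fun e => ~ W (e 0%N) (e 1%N)) by apply: definable_not.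
pose A x := right_germ (W x) x; pose B y := left_germ (fun x => W x y) y.
have full (V : R -> R -> Prop) :
  (forall x y z, 0 < x -> x < y -> y < z -> z < b -> V x y -> V y z -> V x z) ->
  right_germ (fun x => right_germ (V x) x) 0 ->
  right_germ (fun y => left_germ (fun x => V x y) y) 0 ->
  exists d, 0 < d <= b /\ forall x y, 0 < x -> x < y -> y < d -> V x y.
  move=> tV rA rB; have [d [d0 Hd]] := right_germ_and _ _ _ rA rB.
  exists (Rmin d b); have := Rmin_l d b; have := Rmin_r d b => *.
  have : 0 < Rmin d b by apply: Rmin_pos.
  split; first lra; move=> x y x0 xy yd; apply: chain => //.
  - by move=> u v w *; apply: (tV u v w) => //; lra.
  - by move=> u *; case: (Hd u ltac:(lra)).
  - by move=> u *; case: (Hd u ltac:(lra)).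
(* The section of [W] at [x] is tame, so a germ that fails for [W] is a germ of its negation. *)
have NA : right_germ (fun x => ~ A x) 0 -> right_germ (fun x => right_germ (fun y => ~ W x y) x) 0.
  apply: right_germ_imp => x.
  by have [[h|h] _] := tame_section_right W x dW x.
have NB : right_germ (fun x => ~ B x) 0 -> right_germ (fun y => left_germ (fun x => ~ W x y) y) 0.
  apply: right_germ_imp => x.
  by have [_ [h|h]] := tame_section_left W x dW x.
have [[rA|/NA rA] _] := definable_right_germ W dW 0;
have [[rB|/NB rB] _] := definable_left_germ W dW 0.
- by have [d [d0 H]] := full W tW rA rB; exists d; split=> //; left.
- have [d [d0 H]] := right_germ_and _ _ _ rA rB; exfalso.
  apply: (no_opposite_germs W 0 d) => // c Hc; case: (H c ltac:(lra)) => //.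
- have [d [d0 H]] := right_germ_and _ _ _ rA rB; exfalso.
  apply: (no_opposite_germs (fun x y => ~ W x y) 0 d) => // c Hc; case: (H c ltac:(lra)) => // _.
  by apply: left_germ_imp => x; tauto.
- by have [d [d0 H]] := full _ tNW rA rB; exists d; split=> //; right.
Qed.

(** * Polynomial functions *)

Definition dot {n} (x y : vec n) := \big[Rplus/0]_(i < n) (x i * y i).
(** The working norm: its estimates are coordinatewise, and comparison with the Euclidean norm costs
    a factor [INR n], the origin of such factors below. *)
Definition nrm1 {n} (x : vec n) := \big[Rplus/0]_(i < n) Rabs (x i).

(** * Finite sums and comparison of norms *)

Section Sums.
Context {I : Type}.
Implicit Types (r : seq I) (P : pred I) (F G : I -> R).

Lemma Rsum_le r P F G : (forall i, P i -> F i <= G i) ->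
  \big[Rplus/0]_(i <- r | P i) F i <= \big[Rplus/0]_(i <- r | P i) G i.
Proof.
by move=> H; apply: (big_ind2 (fun a b => a <= b)) => //; [lra | move=> *; lra].
Qed.

Lemma Rsum_ge0 r P F : (forall i, P i -> 0 <= F i) ->
  0 <= \big[Rplus/0]_(i <- r | P i) F i.
Proof. by move=> H; apply: big_ind => //; [lra | move=> *; lra]. Qed.

Lemma Rsum_abs r P F : Rabs (\big[Rplus/0]_(i <- r | P i) F i) <=
  \big[Rplus/0]_(i <- r | P i) Rabs (F i).
Proof.
apply: (big_ind2 (fun a b => Rabs a <= b)); first by rewrite Rabs_R0; lra.
  by move=> a b c d ab cd; have := Rabs_triang a c; lra.
by move=> *; lra.
Qed.

Lemma Rsum_sub r P F G : \big[Rplus/0]_(i <- r | P i) (F i - G i) =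
  \big[Rplus/0]_(i <- r | P i) F i - \big[Rplus/0]_(i <- r | P i) G i.
Proof.
apply: (big_rec3 (fun a b c => c = a - b)); first lra.
by move=> i a b c _ ->; lra.
Qed.
End Sums.

Lemma Rsum_term n (F : 'I_n -> R) i : (forall j, 0 <= F j) ->
  F i <= \big[Rplus/0]_(j < n) F j.
Proof.
move=> H; rewrite (bigD1 i) //=.
by rewrite -{1}[F i]Rplus_0_r; apply: Rplus_le_compat_l; apply: Rsum_ge0.
Qed.

Lemma Rsum_single n (F : 'I_n -> R) i : (forall j, j != i -> F j = 0) ->
  \big[Rplus/0]_(j < n) F j = F i.
Proof. by move=> H; rewrite (bigD1 i) //= big1 ?Rplus_0_r. Qed.

Lemma Rsum_const n (c : R) : \big[Rplus/0]_(j < n) c = INR n * c.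
Proof.
elim: n => [|n IH]; first by rewrite big_ord0 /=; lra.
by rewrite big_ord_recl IH S_INR; lra.
Qed.

Section Norms.
Context {n : nat}.
Implicit Types (x y z : vec n).

Lemma dotC x y : dot x y = dot y x.
Proof. by apply: eq_bigr => i _; rewrite Rmult_comm. Qed.

Lemma dot_ge0 x : 0 <= dot x x.
Proof. by apply: Rsum_ge0 => i _; nra. Qed.

Lemma dot_term x i : x i * x i <= dot x x.
Proof. by apply: (Rsum_term n (fun i => x i * x i) i) => j; nra. Qed.

Lemma dotDl x y z : dot (fun i => x i + y i) z = dot x z + dot y z.
Proof. by rewrite /dot -big_split; apply: eq_bigr => i _ /=; lra. Qed.

Lemma dotZl c x z : dot (fun i => c * x i) z = c * dot x z.
Proof. by rewrite /dot big_distrr; apply: eq_bigr => i _ /=; lra. Qed.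

Lemma dotZr c x z : dot z (fun i => c * x i) = c * dot z x.
Proof. by rewrite dotC dotZl dotC. Qed.

Lemma nrm1_ge0 x : 0 <= nrm1 x.
Proof. by apply: Rsum_ge0 => i _; apply: Rabs_pos. Qed.

Lemma nrm1_term x i : Rabs (x i) <= nrm1 x.
Proof. by apply: (Rsum_term n (fun i => Rabs (x i)) i) => j; apply: Rabs_pos. Qed.

Lemma nrm1_triang x y : nrm1 (fun i => x i + y i) <= nrm1 x + nrm1 y.
Proof.
by rewrite /nrm1 -big_split; apply: Rsum_le => i _; exact: Rabs_triang.
Qed.

Lemma nrm1Z c x : nrm1 (fun i => c * x i) = Rabs c * nrm1 x.
Proof. by rewrite /nrm1 big_distrr; apply: eq_bigr => i _ /=; rewrite Rabs_mult. Qed.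

Lemma nrm1_sub_triang x y z : nrm1 (vsub x z) <= nrm1 (vsub x y) + nrm1 (vsub y z).
Proof.
apply: Rle_trans (nrm1_triang _ _); apply/Req_le; apply: eq_bigr => i _.
by congr Rabs; rewrite /vsub; lra.
Qed.

Lemma nrm1_subC x y : nrm1 (vsub x y) = nrm1 (vsub y x).
Proof. by apply: eq_bigr => i _; rewrite /vsub Rabs_minus_sym. Qed.

Lemma nrm1_eq0 x y : nrm1 (vsub x y) <= 0 -> x = y.
Proof.
move=> H; apply: functional_extensionality => i.
have K : Rabs (x i - y i) <= _ := nrm1_term (vsub x y) i; have := Rabs_pos (x i - y i) => K'.
by have := Rle_abs (x i - y i); have := Rle_abs (- (x i - y i)); rewrite Rabs_Ropp; lra.
Qed.

Lemma coord_le_sqrt x i : Rabs (x i) <= sqrt (dot x x).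
Proof. by rewrite -sqrt_Rsqr_abs; apply/sqrt_le_1_alt/dot_term. Qed.

Lemma nrm1_le_sqrt x : nrm1 x <= INR n * sqrt (dot x x).
Proof. by rewrite -Rsum_const; apply: Rsum_le => i _; exact: coord_le_sqrt. Qed.

(** A substitute for Cauchy-Schwarz with one l1 factor, proved term by term; it loses only a
    constant. *)
Lemma dot_le x y : Rabs (dot x y) <= sqrt (dot x x) * nrm1 y.
Proof.
apply: Rle_trans (Rsum_abs _ _ _) _; rewrite /nrm1 big_distrr /=.
apply: Rsum_le => i _; rewrite Rabs_mult; apply: Rmult_le_compat_r; first exact: Rabs_pos.
exact: coord_le_sqrt.
Qed.

Lemma dot_le_nrm1 x y K : (forall i, Rabs (x i) <= K) -> Rabs (dot x y) <= K * nrm1 y.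
Proof.
move=> H; apply: Rle_trans (Rsum_abs _ _ _) _; rewrite /nrm1 big_distrr /=.
by apply: Rsum_le => i _; rewrite Rabs_mult; apply: Rmult_le_compat_r; [exact: Rabs_pos|].
Qed.

Lemma dot_le_nrm1_sqr x : dot x x <= nrm1 x * nrm1 x.
Proof.
apply: Rle_trans (Rle_abs _) _.
by apply: dot_le_nrm1 => i; exact: nrm1_term.
Qed.

Lemma vnormE x : vnorm x = sqrt (dot x x).
Proof. by rewrite /vnorm; congr sqrt; apply: eq_bigr => i _; rewrite /= Rmult_1_r. Qed.

Lemma vnorm_le_nrm1 x : vnorm x <= nrm1 x.
Proof.
rewrite vnormE -[nrm1 x]sqrt_Rsqr; last exact: nrm1_ge0.
exact/sqrt_le_1_alt/dot_le_nrm1_sqr.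
Qed.

Lemma nrm1_le_vnorm x : nrm1 x <= INR n * vnorm x.
Proof. by rewrite vnormE; exact: nrm1_le_sqrt. Qed.
End Norms.

Section PolynomialFunctions.
Context {n : nat}.
Implicit Types (x y v : vec n) (p : vec n -> R).

(** Generated by sums and products, so that bounds, Lipschitz constants, derivatives and
    definability each follow by one induction, without a normal form. *)
Inductive polyfun : (vec n -> R) -> Prop :=
| polyfun_const c : polyfun (fun=> c)
| polyfun_var i : polyfun (fun x => x i)
| polyfun_add p q : polyfun p -> polyfun q -> polyfun (fun x => p x + q x)
| polyfun_mul p q : polyfun p -> polyfun q -> polyfun (fun x => p x * q x).

Lemma polyfun_sum (I : Type) (r : seq I) (F : I -> vec n -> R) :
  (forall i, polyfun (F i)) -> polyfun (fun x => \big[Rplus/0]_(i <- r) F i x).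
Proof.
move=> H; elim: r => [|i r IH].
  have -> : (fun x => \big[Rplus/0]_(i <- [::]) F i x) = (fun=> 0).
    by apply: functional_extensionality => x; rewrite big_nil.
  exact: polyfun_const.
have -> : (fun x => \big[Rplus/0]_(i <- i :: r) F i x) = (fun x => F i x + \big[Rplus/0]_(i <- r) F i x).
  by apply: functional_extensionality => x; rewrite big_cons.
exact: polyfun_add.
Qed.

Lemma polyfun_prod (I : Type) (r : seq I) (F : I -> vec n -> R) :
  (forall i, polyfun (F i)) -> polyfun (fun x => \big[Rmult/1]_(i <- r) F i x).
Proof.
move=> H; elim: r => [|i r IH].
  have -> : (fun x => \big[Rmult/1]_(i <- [::]) F i x) = (fun=> 1).
    by apply: functional_extensionality => x; rewrite big_nil.
  exact: polyfun_const.
have -> : (fun x => \big[Rmult/1]_(i <- i :: r) F i x) = (fun x => F i x * \big[Rmult/1]_(i <- r) F i x).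
  by apply: functional_extensionality => x; rewrite big_cons.
exact: polyfun_mul.
Qed.

Lemma polyfun_pow p k : polyfun p -> polyfun (fun x => p x ^ k).
Proof. by move=> H; elim: k => [|k IH] /=; [exact: polyfun_const|exact: polyfun_mul]. Qed.

Lemma polyfun_dot (a b : vec n -> vec n) : (forall i, polyfun (fun x => a x i)) ->
  (forall i, polyfun (fun x => b x i)) -> polyfun (fun x => dot (a x) (b x)).
Proof. by move=> Ha Hb; apply: polyfun_sum => i; apply: polyfun_mul. Qed.

Lemma homog_polyfun m phi : is_homog_poly n m phi -> polyfun phi.
Proof.
move=> [l [_ H]].
have -> : phi = fun x => \big[Rplus/0]_(q <- l) (fun q : R * ('I_n -> nat) => q.1 * monomial q.2 x) q.
  exact: functional_extensionality.
apply: polyfun_sum => i; apply: polyfun_mul; first exact: polyfun_const.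
by apply: polyfun_prod => j; apply: polyfun_pow; exact: polyfun_var.
Qed.

Lemma homog_scale m phi s x : is_homog_poly n m phi ->
  phi (fun i => s * x i) = s ^ m * phi x.
Proof.
move=> [l [Hl H]]; rewrite !H.
have E (q : R * ('I_n -> nat)) : List.In q l ->
    monomial q.2 (fun i => s * x i) = s ^ m * monomial q.2 x.
  move=> /Hl <-; rewrite /monomial.
  apply: (big_rec3 (fun a (b : nat) c => c = s ^ b * a)); first by rewrite /=; lra.
  by move=> i a b c _ ->; rewrite pow_add Rpow_mult_distr; lra.
elim: l E {Hl H} => [|a l IH] E; first by rewrite !big_nil; lra.
rewrite !big_cons IH => [|p Hp]; last by apply: E; right.
by rewrite E; [lra | left].
Qed.

Lemma polyfun_bounded p rho : polyfun p ->
  exists K, 0 <= K /\ forall x, nrm1 x <= rho -> Rabs (p x) <= K.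
Proof.
elim=> [c|i|a b _ [K [K0 HK]] _ [L [L0 HL]]|a b _ [K [K0 HK]] _ [L [L0 HL]]].
- by exists (Rabs c); split; [exact: Rabs_pos|move=> *; lra].
- exists (Rabs rho); split; first exact: Rabs_pos.
  by move=> x H; have := nrm1_term x i; have := Rle_abs rho; lra.
- exists (K + L); split; first lra; move=> x Hx.
  by have := Rabs_triang (a x) (b x); have := HK x Hx; have := HL x Hx; lra.
- exists (K * L); split; first nra; move=> x Hx; rewrite Rabs_mult.
  by apply: Rmult_le_compat; auto; exact: Rabs_pos.
Qed.

Lemma polyfun_lipschitz p rho : polyfun p ->
  exists L, 0 <= L /\ forall x y, nrm1 x <= rho -> nrm1 y <= rho ->
    Rabs (p y - p x) <= L * nrm1 (vsub y x).
Proof.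
elim=> [c|i|a b _ [K [K0 HK]] _ [L [L0 HL]]|a b pa [K [K0 HK]] pb [L [L0 HL]]].
- by exists 0; split; [lra|move=> *; rewrite Rminus_diag Rabs_R0; lra].
- exists 1; split; first lra.
  by move=> x y _ _; have : Rabs (y i - x i) <= _ := nrm1_term (vsub y x) i; lra.
- exists (K + L); split; first lra; move=> x y Hx Hy.
  have -> : a y + b y - (a x + b x) = (a y - a x) + (b y - b x) by lra.
  by have := Rabs_triang (a y - a x) (b y - b x); have := HK x y Hx Hy; have := HL x y Hx Hy; lra.
- have [A [A0 HA]] := polyfun_bounded a rho pa; have [B [B0 HB]] := polyfun_bounded b rho pb.
  exists (A * L + B * K); split; first nra; move=> x y Hx Hy.
  have -> : a y * b y - a x * b x = a y * (b y - b x) + b x * (a y - a x) by lra.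
  apply: Rle_trans (Rabs_triang _ _) _; rewrite !Rabs_mult.
  have h1 : Rabs (a y) * Rabs (b y - b x) <= A * (L * nrm1 (vsub y x)).
    by apply: Rmult_le_compat; auto; exact: Rabs_pos.
  have h2 : Rabs (b x) * Rabs (a y - a x) <= B * (K * nrm1 (vsub y x)).
    by apply: Rmult_le_compat; auto; exact: Rabs_pos.
  lra.
Qed.

(** First order Taylor expansion, uniform on balls. Unlike [chain_rule] it applies between two
    arbitrary points, hence along a curve that is not differentiable. *)
Definition quadratic_remainder (p : vec n -> R) (dp : vec n -> vec n) :=
  forall rho, exists L, 0 <= L /\ forall x y, nrm1 x <= rho -> nrm1 y <= rho ->
    Rabs (p y - p x - dot (dp x) (vsub y x)) <= L * (nrm1 (vsub y x) * nrm1 (vsub y x)).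

Definition chain_rule (p : vec n -> R) (dp : vec n -> vec n) :=
  forall (u : R -> vec n) v t, (forall i, derivable_pt_lim (fun s => u s i) t (v i)) ->
    derivable_pt_lim (fun s => p (u s)) t (dot (dp (u t)) v).

Lemma polyfun_derivative p : polyfun p -> exists dp,
  (forall i, polyfun (fun x => dp x i)) /\ quadratic_remainder p dp /\ chain_rule p dp.
Proof.
elim=> [c|i|a b pa [da [Pa [Qa Ca]]] pb [db [Pb [Qb Cb]]]
       |a b pa [da [Pa [Qa Ca]]] pb [db [Pb [Qb Cb]]]].
- exists (fun _ _ => 0).
  have E (v : vec n) : dot (fun=> 0) v = 0 by rewrite /dot big1 // => i _; lra.
  split; first by move=> i; exact: polyfun_const.
  split=> [rho|u v t _].
    by exists 0; split; [lra | move=> x y _ _; rewrite E !Rminus_diag Rabs_R0; lra].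
  by rewrite E; exact: derivable_pt_lim_const.
- exists (fun _ j => if j == i then 1 else 0).
  have E (v : vec n) : dot (fun j => if j == i then 1 else 0) v = v i.
    by rewrite /dot (Rsum_single _ _ i) ?eqxx; [lra | move=> j /negbTE ->; lra].
  split; first by move=> j; exact: polyfun_const.
  split=> [rho|u v t H]; last by rewrite E.
  exists 0; split; first lra; move=> x y _ _.
  by rewrite E /vsub (_ : _ - _ = 0); [rewrite Rabs_R0; lra | lra].
- exists (fun x i => da x i + db x i); split; first by move=> i; exact: polyfun_add.
  split=> [rho|u v t H].
    have [K [K0 HK]] := Qa rho; have [L [L0 HL]] := Qb rho.
    exists (K + L); split; first lra; move=> x y Hx Hy; rewrite dotDl.
    have := HK x y Hx Hy; have := HL x y Hx Hy.
    set A := dot _ _; set B := dot _ _ => h1 h2.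
    have -> : a y + b y - (a x + b x) - (B + A) = (a y - a x - B) + (b y - b x - A) by lra.
    apply: Rle_trans (Rabs_triang _ _) _; lra.
  by rewrite dotDl; apply: derivable_pt_lim_plus; [exact: Ca|exact: Cb].
- exists (fun x i => b x * da x i + a x * db x i); split.
    by move=> i; apply: polyfun_add; apply: polyfun_mul.
  split=> [rho|u v t H]; last first.
    rewrite dotDl !dotZl Rmult_comm.
    by apply: derivable_pt_lim_mult; [exact: Ca|exact: Cb].
  have [K [K0 HK]] := Qa rho; have [L [L0 HL]] := Qb rho.
  have [A [A0 HA]] := polyfun_bounded a rho pa; have [B [B0 HB]] := polyfun_bounded b rho pb.
  have [C [C0 HC]] := polyfun_lipschitz a rho pa; have [D [D0 HD]] := polyfun_lipschitz b rho pb.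
  exists (B * K + A * L + C * D); split; first nra; move=> x y Hx Hy.
  rewrite dotDl !dotZl.
  have := HK x y Hx Hy; have := HL x y Hx Hy; have := HC x y Hx Hy; have := HD x y Hx Hy.
  have := HA x Hx; have := HB x Hx.
  set U := dot _ _; set V := dot _ _; set N := nrm1 _ => h1 h2 h3 h4 h5 h6.
  (* The remainder of a product: each remainder times a bounded factor, plus a product of two
     increments, which is quadratic by the Lipschitz bounds. *)
  have -> : a y * b y - a x * b x - (b x * V + a x * U) =
    b x * (a y - a x - V) + a x * (b y - b x - U) + (a y - a x) * (b y - b x) by lra.
  apply: Rle_trans (Rabs_triang _ _) _.
  have := Rabs_triang (b x * (a y - a x - V)) (a x * (b y - b x - U)); rewrite !Rabs_mult.
  have g1 : Rabs (b x) * Rabs (a y - a x - V) <= B * (K * (N * N)).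
    by apply: Rmult_le_compat => //; exact: Rabs_pos.
  have g2 : Rabs (a x) * Rabs (b y - b x - U) <= A * (L * (N * N)).
    by apply: Rmult_le_compat => //; exact: Rabs_pos.
  have g3 : Rabs (a y - a x) * Rabs (b y - b x) <= (C * N) * (D * N).
    by apply: Rmult_le_compat => //; exact: Rabs_pos.
  lra.
Qed.

(** Partial derivatives are unique, so [g] coincides with the formal gradient built by induction;
    [chain_rule] along a coordinate line identifies the two. *)
Lemma gradient_polyfun p g : polyfun p -> is_gradient p g ->
  (forall i, polyfun (fun x => g x i)) /\ quadratic_remainder p g /\ chain_rule p g.
Proof.
move=> pp Hg; have [dp [P [Q C]]] := polyfun_derivative p pp.
suff -> : g = dp by [].
apply: functional_extensionality => x; apply: functional_extensionality => i.
apply: uniqueness_limite (Hg x i) _.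
have := C (fun s => vshift x i s) (fun j => if j == i then 1 else 0) 0.
have -> : vshift x i 0 = x.
  by apply: functional_extensionality => j; rewrite /vshift; case: eqP => _ //; lra.
have -> : dot (dp x) (fun j => if j == i then 1 else 0) = dp x i.
  by rewrite /dot (Rsum_single _ _ i) ?eqxx; [lra | move=> j /negbTE ->; lra].
apply=> j; rewrite /vshift; case: eqP => _; last exact: derivable_pt_lim_const.
rewrite (_ : 1 = 0 + 1); last lra.
by apply: derivable_pt_lim_plus; [exact: derivable_pt_lim_const|exact: derivable_pt_lim_id].
Qed.

(** Convention for formulas about vectors: a vector occupies the [n] consecutive variables from [b]
    on. *)
Lemma polyfun_definable p (b : nat) : polyfun p ->
  definable_fun (fun e => p (fun i => e (b + i)%N)).
Proof.
elim=> [c|i|a q _ Ha _ Hq|a q _ Ha _ Hq].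
- exact: definable_fun_const.
- exact: definable_fun_var.
- exact: definable_fun_add.
- exact: definable_fun_mul.
Qed.

(** Differentiate s -> phi(s x) at s = 1, once by the chain rule and once as s^m phi(x). *)
Lemma Euler_identity m phi g x : (1 <= m)%N -> is_homog_poly n m phi -> chain_rule phi g ->
  dot (g x) x = INR m * phi x.
Proof.
move=> m1 H C.
have D1 : derivable_pt_lim (fun s => phi (fun i => s * x i)) 1 (dot (g x) x).
  have := C (fun s i => s * x i) x 1.
  have -> : (fun i : 'I_n => 1 * x i) = x by apply: functional_extensionality => i; lra.
  apply=> i; rewrite -[x i in X in derivable_pt_lim _ _ X]Rmult_1_l.
  have E : 1 * x i = 1 * x i + 1 * 0 by lra.
  rewrite E; apply: (derivable_pt_lim_mult id (fun=> x i)).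
    exact: derivable_pt_lim_id.
  exact: derivable_pt_lim_const.
apply: uniqueness_limite D1 _.
have -> : (fun s => phi (fun i => s * x i)) = (fun s => s ^ m * phi x).
  by apply: functional_extensionality => s; exact: homog_scale.
have E : INR m * phi x = (INR m * 1 ^ m.-1) * phi x + 1 ^ m * 0 by rewrite pow1; lra.
rewrite E; apply: (derivable_pt_lim_mult (fun s => s ^ m) (fun=> phi x)).
  exact: derivable_pt_lim_pow.
exact: derivable_pt_lim_const.
Qed.
End PolynomialFunctions.

(** * Definable choice on level sets *)

Lemma ord_uniform_nat n (P : 'I_n -> nat -> Prop) :
  (forall i, exists N, forall k, (N <= k)%N -> P i k) ->
  exists N, forall k, (N <= k)%N -> forall i, P i k.
Proof.
elim: n P => [|n IH] P H; first by exists 0%N => k _ [].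
have [N HN] := IH (fun i => P (lift ord0 i)) (fun i => H _).
have [M HM] := H ord0; exists (maxn M N) => k; rewrite geq_max => /andP[Mk Nk] i.
by case: (unliftP ord0 i) => [j ->|->]; [exact: HN|exact: HM].
Qed.

Lemma ord_uniform_pos n (P : 'I_n -> R -> Prop) :
  (forall i, exists d, 0 < d /\ forall r, 0 < r <= d -> P i r) ->
  exists d, 0 < d /\ forall r, 0 < r <= d -> forall i, P i r.
Proof.
elim: n P => [|n IH] P H; first by exists 1; split=> [|r _ []//]; lra.
have [N [N0 HN]] := IH (fun i => P (lift ord0 i)) (fun i => H _).
have [M [M0 HM]] := H ord0; exists (Rmin M N); split; first exact: Rmin_pos.
move=> k Hk i; have := Rmin_l M N; have := Rmin_r M N => *.
by case: (unliftP ord0 i) => [j ->|->]; [apply: HN|apply: HM]; lra.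
Qed.

(** * Compactness and minima on closed bounded sets *)

Lemma bounded_subsequence (u : nat -> R) K : (forall k, Rabs (u k) <= K) ->
  exists t : nat -> nat, (forall k, (t k < t k.+1)%N) /\
    exists l, Un_cv (fun k => u (t k)) l.
Proof.
move=> HK.
have bK k : - K <= u k <= K.
  by have := HK k; have := Rle_abs (u k); have := Rle_abs (- u k); rewrite Rabs_Ropp; lra.
have [l Hl] := Bolzano_Weierstrass u (fun x => - K <= x <= K) (compact_P3 _ _) bK.
have step (p : nat * nat) : exists q, (p.2 < q)%N /\ Rabs (u q - l) < / INR p.1.+1.
  have ip : 0 < / INR p.1.+1 by apply/Rinv_0_lt_compat/lt_0_INR; lia.
  have [|q [qp Hq]] := Hl (fun x => Rabs (x - l) < / INR p.1.+1) p.2.+1.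
    by exists (mkposreal _ ip) => x; rewrite /disc.
  by exists q; split=> //; apply/ltP; lia.
pose nxt p := proj1_sig (constructive_indefinite_description _ (step p)).
have nxtP p := proj2_sig (constructive_indefinite_description _ (step p)).
pose t := fix t k := if k is k'.+1 then nxt (k', t k') else 0%N.
exists t; split; first by move=> k; case: (nxtP (k, t k)).
exists l => eps e0; have [N [HN N0]] := archimed_cor1 eps e0.
exists N.+1 => -[|k] Hk; first lia.
have [_ H] : _ /\ Rabs (u (t k.+1) - l) < / INR k.+1 := nxtP (k, t k).
apply: Rlt_trans H _.
apply: Rle_lt_trans HN; apply: Rinv_le_contravar; first exact: lt_0_INR.
by apply: le_INR; lia.
Qed.

Lemma increasing_ge (t : nat -> nat) : (forall k, (t k < t k.+1)%N) -> forall k, (k <= t k)%N.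
Proof. by move=> H; elim=> [//|k IH]; apply: leq_ltn_trans IH (H k). Qed.

Lemma bounded_cluster n (u : nat -> vec n) K : (forall k, nrm1 (u k) <= K) ->
  exists x, forall eps, 0 < eps -> forall N, exists k, (N <= k)%N /\ nrm1 (vsub (u k) x) < eps.
Proof.
move=> HK.
(* Subsequences are extracted coordinate by coordinate: after [j] rounds the first [j] coordinates
   converge. *)
have H j : exists s : nat -> nat, (forall k, (s k < s k.+1)%N) /\ exists x : vec n,
    forall i : 'I_n, (i < j)%N -> Un_cv (fun k => u (s k) i) (x i).
  elim: j => [|j [s [si [x Hx]]]]; first by exists id; split=> //; exists (fun=> 0).
  case: (leqP n j) => [nj|jn].
    by exists s; split=> //; exists x => i _; apply: Hx; exact: leq_trans nj.
  pose i0 := Ordinal jn.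
  have [|t [ti [l Hl]]] := bounded_subsequence (fun k => u (s k) i0) K.
    by move=> k; have := nrm1_term (u (s k)) i0; have := HK (s k); lra.
  have smono a b : (a < b)%N -> (s a < s b)%N.
    elim: b => // b IH; rewrite ltnS leq_eqVlt => /orP[/eqP ->|/IH] //.
    by move/ltn_trans; apply.
  exists (fun k => s (t k)); split; first by move=> k; apply: smono.
  exists (fun i => if i == i0 then l else x i) => i; rewrite ltnS leq_eqVlt => /orP[ij|ij].
    have -> : i = i0 by apply/val_inj/eqP.
    by rewrite eqxx.
  have -> : (i == i0) = false by rewrite -val_eqE /= ltn_eqF.
  move=> eps e0; have [N HN] := Hx i ij eps e0; exists N => k Hk; apply: HN.
  by have /leP := increasing_ge t ti k; lia.
have [s [si [x Hx]]] := H n; exists x => eps e0 N.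
have n0 : 0 < INR n + 1 by have := pos_INR n; lra.
have [M HM] := ord_uniform_nat n (fun i k => Rabs (u (s k) i - x i) < eps / (INR n + 1))
  ltac:(move=> i; have [M HM] := Hx i (ltn_ord i) (eps / (INR n + 1)) ltac:(exact: Rdiv_lt_0_compat);
    by exists M => k /leP Hk; apply: HM; lia).
exists (s (maxn M N)); split.
  by apply: leq_trans (increasing_ge s si _); exact: leq_maxr.
have : nrm1 (vsub (u (s (maxn M N))) x) <= INR n * (eps / (INR n + 1)).
  rewrite -Rsum_const; apply: Rsum_le => i _; apply: Rlt_le.
  by apply: HM; exact: leq_maxl.
move/Rle_lt_trans; apply.
apply: (Rmult_lt_reg_r (INR n + 1)) => //; field_simplify; last lra.
by have := pos_INR n; nra.
Qed.

Definition seq_closed {n} (S : vec n -> Prop) := forall x,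
  (forall eps, 0 < eps -> exists y, S y /\ nrm1 (vsub y x) < eps) -> S x.

Lemma polyfun_continuous n (p : vec n -> R) x eps : polyfun p -> 0 < eps ->
  exists d, 0 < d /\ forall y, nrm1 (vsub y x) < d -> Rabs (p y - p x) < eps.
Proof.
move=> pp e0; have [L [L0 HL]] := polyfun_lipschitz p (nrm1 x + 1) pp.
exists (Rmin 1 (eps / (L + 1))); split.
  by apply: Rmin_pos; [lra | apply: Rdiv_lt_0_compat; lra].
move=> y Hy; have := Rmin_l 1 (eps / (L + 1)); have := Rmin_r 1 (eps / (L + 1)) => h1 h2.
have yx : nrm1 y <= nrm1 x + 1.
  have -> : y = (fun i => vsub y x i + x i).
    by apply: functional_extensionality => i; rewrite /vsub; lra.
  by have := nrm1_triang (vsub y x) x; lra.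
have := HL x y ltac:(lra) yx.
have : (L + 1) * nrm1 (vsub y x) < eps.
  have : nrm1 (vsub y x) < eps / (L + 1) by lra.
  move/(Rmult_lt_compat_l (L + 1) _ _ ltac:(lra)).
  by have -> : (L + 1) * (eps / (L + 1)) = eps by field; lra.
by have := nrm1_ge0 (vsub y x); nra.
Qed.

Lemma closed_le n (p : vec n -> R) c : polyfun p -> seq_closed (fun x => p x <= c).
Proof.
move=> pp x H; apply: Rnot_lt_le => K.
have [d [d0 Hd]] := polyfun_continuous n p x (p x - c) pp ltac:(lra).
have [y [py yx]] := H d d0; have := Hd y yx.
by have := Rle_abs (- (p y - p x)); rewrite Rabs_Ropp; lra.
Qed.

Lemma closed_and n (S T : vec n -> Prop) : seq_closed S -> seq_closed T ->
  seq_closed (fun x => S x /\ T x).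
Proof.
move=> cS cT x H; split; [apply: cS|apply: cT] => eps /H[y [[Sy Ty] yx]]; by exists y.
Qed.

Lemma closed_all n (I : Type) (S : I -> vec n -> Prop) : (forall i, seq_closed (S i)) ->
  seq_closed (fun x => forall i, S i x).
Proof. by move=> cS x H i; apply: cS => eps /H[y [Sy yx]]; exists y. Qed.

Lemma closed_imp n (P : Prop) (S : vec n -> Prop) : seq_closed S ->
  seq_closed (fun x => P -> S x).
Proof. by move=> cS x H p; apply: cS => eps /H[y [Sy yx]]; exists y; split; auto. Qed.

Lemma polyfun_argmin n (S : vec n -> Prop) (h : vec n -> R) K : polyfun h ->
  seq_closed S -> (forall x, S x -> nrm1 x <= K) -> (exists x, S x) ->
  exists x, S x /\ forall y, S y -> h x <= h y.
Proof.
move=> ph cS bS [x0 Sx0].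
have [B [B0 HB]] := polyfun_bounded h K ph.
(* The infimum of [h] is [- m], obtained as a supremum of [- h]; a cluster point of a minimizing
   sequence attains it. *)
have [m [ub lub]] : {m | is_lub (fun r => exists x, S x /\ r = - h x) m}.
  apply: completeness; last by exists (- h x0), x0.
  exists B => r [x [Sx ->]]; have := HB x (bS x Sx).
  by have := Rle_abs (- h x); rewrite Rabs_Ropp; lra.
have lo y : S y -> - m <= h y by move=> Sy; have := ub (- h y) ltac:(by exists y); lra.
have ap (k : nat) : exists x, S x /\ h x < - m + / INR k.+1.
  apply: NNPP => H; have ip : 0 < / INR k.+1 by apply/Rinv_0_lt_compat/lt_0_INR; lia.
  have : m <= m - / INR k.+1; last lra.
  apply: lub => r [x [Sx ->]]; suff : - m + / INR k.+1 <= h x by lra.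
  by apply: Rnot_lt_le => hx; apply: H; exists x.
pose u k := proj1_sig (constructive_indefinite_description _ (ap k)).
have uP k : S (u k) /\ h (u k) < - m + / INR k.+1 :=
  proj2_sig (constructive_indefinite_description _ (ap k)).
have [x Hx] := bounded_cluster n u K (fun k => bS _ (uP k).1).
exists x; split.
  by apply: cS => eps e0; have [k [_ Hk]] := Hx eps e0 0%N; exists (u k); split=> //; case: (uP k).
move=> y Sy; apply: Rle_trans (lo y Sy); apply: Rnot_lt_le => hm.
have [d [d0 Hd]] := polyfun_continuous n h x ((h x + m) / 2) ph ltac:(lra).
have [N [HN N0]] := archimed_cor1 ((h x + m) / 2) ltac:(lra).
have [k [Nk Hk]] := Hx d d0 N; have := Hd _ Hk; have [_] := uP k.
have : / INR k.+1 <= / INR N.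
  by apply: Rinv_le_contravar; [exact: lt_0_INR | apply: le_INR; move/leP: Nk; lia].
have := Rle_abs (- (h (u k) - h x)); rewrite Rabs_Ropp; lra.
Qed.

(** * Quantification over a vector *)

Lemma definable_all_block Q (b k : nat) : definable Q ->
  definable (fun e => forall y : nat -> R,
    Q (fun j => if (b <= j < b + k)%N then y j else e j)).
Proof.
move=> dQ; elim: k => [|k IH].
  apply: definable_ext dQ => e; rewrite addn0.
  have E (y : nat -> R) : (fun j => if (b <= j < b)%N then y j else e j) = e.
    by apply: functional_extensionality => j; rewrite ltnNge; case: (b <= j)%N.
  by split; [move=> H y; rewrite E | move=> /(_ e); rewrite E].
apply: definable_ext (definable_all _ (b + k)%N IH) => e.
have E x (y : nat -> R) : y (b + k)%N = x ->
    (fun j => if (b <= j < b + k)%N then y j else upd e (b + k)%N x j) =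
    (fun j => if (b <= j < b + k.+1)%N then y j else e j).
  move=> yx; apply: functional_extensionality => j; rewrite /upd addnS ltnS (leq_eqVlt j).
  case: (eqVneq j (b + k)%N) => [->|ne]; first by rewrite ltnn leq_addr /= yx.
  by [].
split=> H.
  by move=> y; rewrite -(E (y (b + k)%N)) //; apply: H.
move=> x y.
have := H (fun j => if j == (b + k)%N then x else y j).
rewrite -(E x) ?eqxx //; set f1 := (fun j => _); set f2 := (fun j => _) => H'.
suff -> : f2 = f1 by [].
apply: functional_extensionality => j; rewrite /f1 /f2.
by case: (eqVneq j (b + k)%N) => [->|//]; rewrite ltnn andbF.
Qed.

(* Variables from b on are overwritten by y, so P may only read those below b. *)
Lemma definable_all_vec n (P : (nat -> R) -> vec n -> Prop) (b : nat) :
  definable (fun e => P e (fun i => e (b + i)%N)) ->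
  (forall e e' y, (forall j, (j < b)%N -> e j = e' j) -> P e y -> P e' y) ->
  definable (fun e => forall y, P e y).
Proof.
move=> dP loc; apply: definable_ext (definable_all_block _ b n dP) => e.
pose ov (y : nat -> R) := fun j => if (b <= j < b + n)%N then y j else e j.
have ovE (y : nat -> R) : (fun i : 'I_n => ov y (b + i)%N) = (fun i => y (b + i)%N).
  by apply: functional_extensionality => i; rewrite /ov leq_addr ltn_add2l ltn_ord.
have ovlo (y : nat -> R) j : (j < b)%N -> ov y j = e j.
  by move=> jb; rewrite /ov leqNgt jb.
split=> H y.
  (* For [j < b] the truncated difference is 0, which is harmless: [ov] reads [y'] only inside the
     block. *)
  pose y' j := if insub (j - b)%N is Some i then y i else 0.
  have := H y'; rewrite -/(ov y') ovE.
  have -> : (fun i : 'I_n => y' (b + i)%N) = y.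
    by apply: functional_extensionality => i; rewrite /y' addKn valK.
  by apply: loc => j /ovlo.
rewrite -/(ov y) ovE; apply: loc (H _) => j jb; by rewrite ovlo.
Qed.

(** * Lexicographic minimizers *)

Section LexicographicSelection.
Context {n : nat}.
Context (C : R -> vec n -> Prop) (h : nat -> vec n -> R).

(** A relation and not a selected point: this keeps it first order, so that definability passes from
    [C] to each stage. *)
Fixpoint lexmin (k : nat) (c : R) (x : vec n) : Prop :=
  if k is k'.+1 then lexmin k' c x /\ forall y, lexmin k' c y -> h k' x <= h k' y
  else C c x.

Context (ph : forall k, polyfun (h k)).

Lemma lexmin_closed c k : seq_closed (C c) -> seq_closed (lexmin k c).
Proof.
move=> cC; elim: k => [//|k IH] /=; apply: closed_and => //.
by apply: closed_all => y; apply: closed_imp; exact: closed_le.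
Qed.

Lemma lexmin_le c k j x : (j <= k)%N -> lexmin k c x -> lexmin j c x.
Proof.
elim: k => [|k IH]; first by rewrite leqn0 => /eqP ->.
by rewrite leq_eqVlt => /orP[/eqP -> //|jk] /= [/IH H _]; apply: H.
Qed.

Lemma lexmin_ex c k K : seq_closed (C c) -> (forall x, C c x -> nrm1 x <= K) ->
  (exists x, C c x) -> exists x, lexmin k c x.
Proof.
move=> cC bC neC; elim: k => [//|k IH] /=.
apply: (polyfun_argmin _ _ _ K) => //; first exact: lexmin_closed.
by move=> x /(lexmin_le c k 0) Cx; apply/bC/Cx.
Qed.

Lemma lexmin_definable k j b : (j < b)%N ->
  (forall j b, (j < b)%N -> definable (fun e => C (e j) (fun i => e (b + i)%N))) ->
  definable (fun e => lexmin k (e j) (fun i => e (b + i)%N)).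
Proof.
move=> jb dC; elim: k j b jb => [|k IH] j b jb /=; first exact: dC.
apply: definable_and; first exact: IH.
(* The competitor [y] is stored from [b + n] on, just after the block of the point being tested. *)
apply: (definable_all_vec n (fun e y => lexmin k (e j) y -> h k (fun i => e (b + i)%N) <= h k y) (b + n)).
  apply: definable_imp; first by apply: IH; apply: ltn_addr.
  by apply: definable_le; apply: polyfun_definable.
move=> e e' y E H; rewrite -E; last exact: ltn_addr.
suff <- : (fun i : 'I_n => e (b + i)%N) = (fun i : 'I_n => e' (b + i)%N) by [].
by apply: functional_extensionality => i; apply: E; rewrite ltn_add2l.
Qed.
End LexicographicSelection.

(** The first alternative is the case where the ball misses all small positive levels. In the
    second, [V] measures chords of [gamma] exactly, since its coordinates are monotone. *)
Lemma level_curve n (phi h : vec n -> R) rho : polyfun phi -> polyfun h ->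
  exists d, 0 < d /\
  ((forall c x, 0 < c < d -> dot x x <= rho -> phi x <> c) \/
   exists (gamma : R -> vec n) (V : R -> R),
     (forall c, 0 < c < d -> phi (gamma c) = c /\ dot (gamma c) (gamma c) <= rho /\
        forall y, phi y = c -> dot y y <= rho -> h (gamma c) <= h y) /\
     (forall c c', 0 < c -> c < c' -> c' < d ->
        nrm1 (vsub (gamma c') (gamma c)) = V c' - V c)).
Proof.
move=> pphi ph.
pose C c (x : vec n) := phi x = c /\ dot x x <= rho.
have pdot : polyfun (fun x : vec n => dot x x).
  by apply: (polyfun_dot id id) => i; exact: polyfun_var.
have dC j b : (j < b)%N -> definable (fun e => C (e j) (fun i => e (b + i)%N)).
  move=> jb; apply: definable_and.
    by apply: definable_eq; [exact: polyfun_definable|exact: definable_fun_var].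
  by apply: definable_le; [exact: (polyfun_definable (fun x => dot x x))|exact: definable_fun_const].
have cC c : seq_closed (C c).
  have cl : seq_closed (fun x => (phi x <= c /\ -1 * phi x <= - c) /\ dot x x <= rho).
    apply: closed_and; last exact: closed_le.
    apply: closed_and; first exact: closed_le.
    by apply: closed_le; apply: polyfun_mul => //; exact: polyfun_const.
  move=> x H; have [|? ?] := cl x; last by split; lra.
  by move=> eps /H[y [[<- Cy] yx]]; exists y; split=> //; split=> //; lra.
have bC c x : C c x -> nrm1 x <= INR n * sqrt rho.
  move=> [_ xr]; apply: Rle_trans (nrm1_le_sqrt x) _.
  by apply: Rmult_le_compat_l; [exact: pos_INR|exact: sqrt_le_1_alt].
have tN : tame (fun c => forall x, ~ C c x).
  apply: (tame_definable _ 0%N).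
  apply: (definable_all_vec n (fun e x => ~ C (e 0%N) x) 1).
    by apply: definable_not; exact: dC.
  by move=> e e' y E; rewrite (E 0%N).
(* Tameness at 0: either all small positive levels miss the ball or all of them meet it. *)
have [[[d [d0 Hd]]|[d [d0 Hd]]] _] := tN 0.
  by exists d; split=> //; left=> c x cd xr pc; case: (Hd c ltac:(lra) x).
have neC c : 0 < c < d -> exists x, C c x.
  by move=> cd; apply: NNPP => H; apply: (Hd c ltac:(lra)) => x Cx; apply: H; exists x.
(* First [h], then the coordinates in order; indices past the last coordinate get the constant 0. *)
pose hh (k : nat) (x : vec n) :=
  if k is k'.+1 then if insub k' is Some i then x i else 0 else h x.
have phh k : polyfun (hh k).
  case: k => [//|k]; rewrite /hh; case: insub => [i|]; first exact: polyfun_var.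
  exact: polyfun_const.
have hhE (i : 'I_n) x : hh i.+1 x = x i by rewrite /hh valK.
(* The stages are [h] and the [n] coordinates, so two points of [S c] agree in every coordinate,
   which is [Sle] used both ways. *)
pose S := lexmin C hh n.+1.
have neS c : 0 < c < d -> exists x, S c x.
  by move=> cd; apply: (lexmin_ex C hh phh c n.+1 (INR n * sqrt rho)); auto; apply: bC.
have Sle c x y i : S c x -> S c y -> x i <= y i.
  move=> Sx Sy.
  have [_ H] : lexmin C hh i.+2 c x by apply: lexmin_le Sx; rewrite ltnS.
  have [K _] : lexmin C hh i.+2 c y by apply: lexmin_le Sy; rewrite ltnS.
  by rewrite -!hhE; exact: H.
have [gamma Hg] : exists gamma : R -> vec n, forall c, 0 < c < d -> S c (gamma c).
  have H c : exists x, 0 < c < d -> S c x.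
    case: (classic (0 < c < d)) => cd; last by exists (fun=> 0).
    by have [x Sx] := neS c cd; exists x.
  exists (fun c => proj1_sig (constructive_indefinite_description _ (H c))) => c.
  exact: (proj2_sig (constructive_indefinite_description _ (H c))).
have dS j b : (j < b)%N -> definable (fun e => S (e j) (fun i => e (b + i)%N)).
  by move=> jb; apply: lexmin_definable.
have mono i : exists e, 0 < e /\ forall r, 0 < r <= e ->
    (forall c c', 0 < c -> c < c' -> c' < r -> gamma c i <= gamma c' i) \/
    (forall c c', 0 < c -> c < c' -> c' < r -> gamma c' i <= gamma c i).
  (* [W] mentions only the definable [S]; as [S c] is the single point [gamma c], it is the
     comparison of coordinate [i] of [gamma]. *)
  pose W c c' := forall x, S c x -> forall y, S c' y -> x i <= y i.
  have WE c c' : 0 < c < d -> 0 < c' < d -> W c c' <-> gamma c i <= gamma c' i.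
    move=> cd cd'; split=> [H|H x Sx y Sy]; first by apply: H; exact: Hg.
    have := Sle c x _ i Sx (Hg c cd); have := Sle c' _ y i (Hg c' cd') Sy; lra.
  have dW : definable (fun e => W (e 0%N) (e 1%N)).
    (* Variables 0 and 1 hold the two levels, [x] starts at 2 and [y] at [2 + n]. *)
    apply: (definable_all_vec n (fun e x => S (e 0%N) x -> forall y, S (e 1%N) y -> x i <= y i) 2).
      apply: definable_imp; first exact: dS.
      apply: (definable_all_vec n (fun e y => S (e 1%N) y -> e (2 + i)%N <= y i) (2 + n)).
        apply: definable_imp; first exact: dS.
        by apply: definable_le; exact: definable_fun_var.
      by move=> e e' y E; rewrite !E // ltn_add2l.
    by move=> e e' y E; rewrite !E.
  have [||e [e0 He]] := definable_dichotomy W d d0 dW.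
  - move=> x y z x0 xy yz zd'; have xd : 0 < x < d by lra.
    have yd : 0 < y < d by lra.
    have zd : 0 < z < d by lra.
    by rewrite !WE //; lra.
  - move=> x y z x0 xy yz zd'; have xd : 0 < x < d by lra.
    have yd : 0 < y < d by lra.
    have zd : 0 < z < d by lra.
    by rewrite !WE //; lra.
  exists e; split=> [|r re]; first lra.
  case: He => H; [left|right] => c c' c0 cc cr.
    have cd : 0 < c < d by lra. have cd' : 0 < c' < d by lra.
    by apply/WE => //; apply: H; lra.
  have cd : 0 < c < d by lra. have cd' : 0 < c' < d by lra.
  by have := H c c' c0 cc ltac:(lra); rewrite WE //; lra.
have [e [e0 He]] := ord_uniform_pos n _ mono.
have := Rmin_l d e; have := Rmin_r d e; have : 0 < Rmin d e by apply: Rmin_pos.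
set r := Rmin d e => r0 re rd.
exists r; split=> //; right.
(* [s i] is 1 or -1 as coordinate [i] increases or decreases, so the signed sum of coordinates
   increases by the l1 length of each chord. *)
have [s Hs] : exists s : 'I_n -> R, forall i c c', 0 < c -> c < c' -> c' < r ->
    Rabs (gamma c' i - gamma c i) = s i * gamma c' i - s i * gamma c i.
  have H i : exists s, forall c c', 0 < c -> c < c' -> c' < r ->
      Rabs (gamma c' i - gamma c i) = s * gamma c' i - s * gamma c i.
    have [M|M] := He r ltac:(lra) i.
      by exists 1 => c c' c0 cc cr; have K := M c c' c0 cc cr; rewrite Rabs_pos_eq; lra.
    by exists (-1) => c c' c0 cc cr; have K := M c c' c0 cc cr; rewrite Rabs_left1; lra.
  exists (fun i => proj1_sig (constructive_indefinite_description _ (H i))) => i.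
  exact: (proj2_sig (constructive_indefinite_description _ (H i))).
exists gamma, (fun c => \big[Rplus/0]_(i < n) (s i * gamma c i)); split.
  move=> c cr; have Sc := Hg c ltac:(lra).
  have [pc rc] : lexmin C hh 0 c (gamma c) by apply: lexmin_le Sc.
  have [_ H] : lexmin C hh 1 c (gamma c) by apply: lexmin_le Sc.
  by split=> //; split=> // y py yr; exact: H.
by move=> c c' c0 cc cr; rewrite -Rsum_sub; apply: eq_bigr => i _; exact: Hs.
Qed.

(** * The talweg *)

(* Since gamma runs through the points of slowest descent, |dc| <= |grad phi (gamma)|
   |d gamma|, and |d gamma| = dV. *)
Lemma talweg n (phi : vec n -> R) (g : vec n -> vec n) rho : polyfun phi ->
  (forall i, polyfun (fun x => g x i)) -> quadratic_remainder phi g ->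
  (forall x, 0 < phi x -> 0 < dot (g x) (g x)) ->
  exists d V B, 0 < d /\
    (forall c c', 0 < c -> c < c' -> c' < d -> 0 <= V c' - V c <= B) /\
    forall c, 0 < c < d -> exists e, 0 < e /\ forall c', 0 < c' < d -> Rabs (c' - c) < e ->
      forall y, phi y = c -> dot y y <= rho ->
        Rabs (c' - c) <= 2 * sqrt (dot (g y) (g y)) * Rabs (V c' - V c).
Proof.
move=> pphi pg Q pos.
have [d [d0 [H|[gamma [V [Hg HV]]]]]] := level_curve n phi (fun x => dot (g x) (g x)) rho pphi
  (polyfun_dot _ _ pg pg).
  exists d, (fun=> 0), 0; split=> //; split; first by move=> *; lra.
  move=> c cd; exists 1; split; first lra.
  by move=> c' _ _ y pc yr; case: (H c y cd yr).
have bg c : 0 < c < d -> nrm1 (gamma c) <= INR n * sqrt rho.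
  move=> cd; have [_ [gr _]] := Hg c cd; apply: Rle_trans (nrm1_le_sqrt _) _.
  by apply: Rmult_le_compat_l; [exact: pos_INR|exact: sqrt_le_1_alt].
exists d, V, (2 * (INR n * sqrt rho)); split=> //; split.
  move=> c c' c0 cc cd; rewrite -HV //; split; first exact: nrm1_ge0.
  have := nrm1_triang (gamma c') (fun i => -1 * gamma c i).
  rewrite nrm1Z (_ : Rabs (-1) = 1); last by rewrite Rabs_left; lra.
  have -> : (fun i => gamma c' i + -1 * gamma c i) = vsub (gamma c') (gamma c).
    by apply: functional_extensionality => i; rewrite /vsub; lra.
  have := bg c ltac:(lra); have := bg c' ltac:(lra); lra.
have HV' c c' : 0 < c < d -> 0 < c' < d ->
    nrm1 (vsub (gamma c') (gamma c)) = Rabs (V c' - V c).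
  move=> cd cd'; case: (Rtotal_order c c') => [cc|[<-|cc]].
  - by rewrite -HV ?Rabs_pos_eq //; [exact: nrm1_ge0|lra|lra].
  - rewrite Rminus_diag Rabs_R0 /nrm1 big1 // => i _.
    by rewrite /vsub Rminus_diag Rabs_R0.
  - by rewrite Rabs_minus_sym -HV ?Rabs_pos_eq ?(nrm1_subC (gamma c)) //;
      [exact: nrm1_ge0|lra|lra].
have [L [L0 HL]] := Q (INR n * sqrt rho).
move=> c cd; have [pc [gr gmin]] := Hg c cd.
set a := sqrt (dot (g (gamma c)) (g (gamma c))).
have a0 : 0 < a by apply: sqrt_lt_R0; apply: pos; rewrite pc; lra.
(* Chosen so that a chord of length at least [a / (L + 1)] satisfies the claim at once, even if
   [gamma] jumps. *)
exists (2 * (a * a) / (L + 1)); split; first by apply: Rdiv_lt_0_compat; nra.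
move=> c' cd' cc y py yr.
have ay : a <= sqrt (dot (g y) (g y)) by apply: sqrt_le_1_alt; exact: gmin.
rewrite -HV' //; set N := nrm1 _; have N0 : 0 <= N by exact: nrm1_ge0.
apply: (Rle_trans _ (2 * a * N)); last by apply: Rmult_le_compat_r => //; lra.
have [pc' _] := Hg c' cd'.
case: (Rle_lt_dec a ((L + 1) * N)) => aN.
  apply: Rlt_le; apply: Rlt_le_trans cc _.
  apply: (Rmult_le_reg_r (L + 1)); first lra.
  have -> : 2 * (a * a) / (L + 1) * (L + 1) = 2 * (a * a) by field; lra.
  nra.
(* Short chord: the Taylor remainder is at most [L * N * N <= a * N], and the linear term at most
   [a * N]; hence the factor 2. *)
have := HL (gamma c) (gamma c') (bg c cd) (bg c' cd'); rewrite pc pc' -/N => h.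
have h2 := dot_le (g (gamma c)) (vsub (gamma c') (gamma c)).
have := Rabs_triang (c' - c - dot (g (gamma c)) (vsub (gamma c') (gamma c)))
  (dot (g (gamma c)) (vsub (gamma c') (gamma c))).
rewrite (_ : c' - c - _ + _ = c' - c); last lra.
rewrite -/N -/a in h2 *; nra.
Qed.

Lemma derivable_local f s l : derivable_pt_lim f s l -> forall eta, 0 < eta ->
  exists d, 0 < d /\ forall t, Rabs (t - s) < d -> Rabs (f t - f s - l * (t - s)) <= eta * Rabs (t - s).
Proof.
move=> H eta e0; have [[d d0] Hd] := H eta e0; exists d; split=> // t td.
case: (Req_dec t s) => [->|ts].
  by rewrite !Rminus_diag Rmult_0_r Rabs_R0 Rminus_0_r Rabs_R0; lra.
have := Hd (t - s) ltac:(lra) td; rewrite (_ : s + (t - s) = t); last lra.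
have p : 0 < Rabs (t - s) by apply: Rabs_pos_lt; lra.
move/Rlt_le/(Rmult_le_compat_r (Rabs (t - s)) _ _ (Rlt_le _ _ p)); rewrite -Rabs_mult.
by rewrite (_ : (_ / _ - l) * _ = f t - f s - l * (t - s)) //; field; lra.
Qed.

(** * Differential inequalities *)

(* Reflecting through 0 turns one-sided continuity into ordinary continuity. *)
Definition right_continuous0 (f : R -> R) := continuity_pt (fun s => f (Rabs s)) 0.

Lemma right_continuous0P f : right_continuous0 f <-> forall eps, 0 < eps ->
  exists d, 0 < d /\ forall s, 0 <= s < d -> Rabs (f s - f 0) < eps.
Proof.
split=> H eps e0; have [d [d0 Hd]] := H eps e0; exists d; split=> // s sd.
  case: (Req_dec s 0) => [->|s0]; first by rewrite Rminus_diag Rabs_R0.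
  have sd' : Rabs (s - 0) < d by rewrite Rminus_0_r Rabs_pos_eq; lra.
  have : Rabs (f (Rabs s) - f (Rabs 0)) < eps := Hd s (conj (conj I (nesym s0)) sd').
  by rewrite Rabs_R0 (Rabs_pos_eq s); [|lra].
have [_ sd'] : _ /\ Rabs (s - 0) < d := sd; rewrite Rminus_0_r in sd'.
rewrite /= /Rdist Rabs_R0; apply: Hd; split=> //; exact: Rabs_pos.
Qed.

Lemma nonincreasing_of_derivative f T :
  (forall t, 0 < t < T -> exists l, l <= 0 /\ derivable_pt_lim f t l) ->
  right_continuous0 f -> forall s t, 0 <= s <= t -> t < T -> f t <= f s.
Proof.
move=> D rc.
have pos s t : 0 < s <= t -> t < T -> f t <= f s.
  move=> st tT; case: (Req_dec s t) => [->|ne]; first lra.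
  have st' : s < t by lra.
  have pr c : s < c < t -> derivable_pt f c.
    move=> sc; have H := D c ltac:(lra).
    by exists (proj1_sig (constructive_indefinite_description _ H));
      case: (proj2_sig (constructive_indefinite_description _ H)).
  have cf c : s <= c <= t -> continuity_pt f c.
    by move=> sc; have [l [_ H]] := D c ltac:(lra); apply: derivable_continuous_pt; exists l.
  have [c [P E]] := MVT f id s t pr (fun c _ => derivable_pt_id c) st' cf
    (fun c _ => derivable_continuous_pt _ _ (derivable_pt_id c)).
  have [l [l0 Hl]] := D c ltac:(lra).
  move: E; rewrite (derive_pt_eq_0 _ _ _ _ Hl) derive_pt_id /id; nra.
move=> s t st tT; case: (Req_dec s 0) => [s0|ne]; last by apply: pos; lra.
rewrite s0; case: (Req_dec t 0) => [->|tn]; first lra.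
(* If f(t) > f(0), right continuity gives a point [m] before [t] with f(m) < f(t), against
   monotonicity on positive times. *)
apply: Rnot_lt_le => K; have [d [d0 Hd]] := (right_continuous0P f).1 rc (f t - f 0) ltac:(lra).
have := Rmin_l (d / 2) t; have := Rmin_r (d / 2) t.
have : 0 < Rmin (d / 2) t by apply: Rmin_pos; lra.
set m := Rmin _ _ => m0 m1 m2.
have h1 := Hd m ltac:(lra); have h2 := pos m t ltac:(lra) tT.
by have := Rle_abs (f m - f 0); lra.
Qed.

Lemma right_continuous0_mul f h : right_continuous0 f -> continuity h ->
  right_continuous0 (fun t => f t * h t).
Proof.
move=> rf ch; apply: (continuity_pt_mult (fun s => f (Rabs s)) (fun s => h (Rabs s))) => //.
by apply: (continuity_pt_comp Rabs h); [exact: Rcontinuity_abs|exact: ch].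
Qed.

(** D e^(-Kt) and -D e^(Kt) are both nonincreasing. The first bound gives dependence on initial
    data, the second keeps distinct trajectories apart. *)
Lemma Gronwall D K : 0 <= K -> right_continuous0 D ->
  (forall t, 0 < t -> exists l, Rabs l <= K * D t /\ derivable_pt_lim D t l) ->
  forall t, 0 <= t -> D t <= D 0 * exp (K * t) /\ D 0 <= D t * exp (K * t).
Proof.
move=> K0 rc HD.
have dexp a t : derivable_pt_lim (fun s => exp (a * s)) t (a * exp (a * t)).
  have H : derivable_pt_lim (fun s => a * s) t a.
    have := derivable_pt_lim_scal id a t 1 (derivable_pt_lim_id t).
    by rewrite Rmult_1_r.
  rewrite [a * exp _]Rmult_comm.
  exact: (derivable_pt_lim_comp _ exp _ _ _ H (derivable_pt_lim_exp _)).
have cexp a : continuity (fun s => exp (a * s)).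
  by move=> t; apply: derivable_continuous_pt; eexists; exact: dexp.
have eK t : exp (- K * t) * exp (K * t) = 1.
  by rewrite -exp_plus (_ : _ + _ = 0) ?exp_0; lra.
move=> t t0; split.
  have := nonincreasing_of_derivative (fun s => D s * exp (- K * s)) (t + 1) _
    (right_continuous0_mul _ _ rc (cexp _)) 0 t ltac:(lra) ltac:(lra).
  rewrite Rmult_0_r exp_0 Rmult_1_r => H.
  have {}H : D t * exp (- K * t) <= D 0.
    apply: H => s s0; have [l [lK Hl]] := HD s ltac:(lra).
    exists (l * exp (- K * s) + D s * (- K * exp (- K * s))); split.
      have h : 0 <= (K * D s - l) * exp (- K * s).
        by apply: Rmult_le_pos; [have := Rle_abs l; lra | exact/Rlt_le/exp_pos].
      lra.
    exact: derivable_pt_lim_mult.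
  by move/(Rmult_le_compat_r _ _ _ (Rlt_le _ _ (exp_pos (K * t)))): H;
    rewrite Rmult_assoc eK Rmult_1_r.
have := nonincreasing_of_derivative (fun s => - D s * exp (K * s)) (t + 1) _
  (right_continuous0_mul _ _ _ (cexp _)) 0 t ltac:(lra) ltac:(lra).
rewrite Rmult_0_r exp_0 Rmult_1_r => H.
suff : - D t * exp (K * t) <= - D 0 by lra.
apply: H.
  move=> s s0; have [l [lK Hl]] := HD s ltac:(lra).
  exists (- l * exp (K * s) + - D s * (K * exp (K * s))); split.
    have h : 0 <= (K * D s + l) * exp (K * s).
      apply: Rmult_le_pos; last exact/Rlt_le/exp_pos.
      by have := Rle_abs (- l); rewrite Rabs_Ropp; lra.
    lra.
  apply: derivable_pt_lim_mult; last exact: dexp.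
  exact: derivable_pt_lim_opp.
exact: continuity_pt_opp.
Qed.

Lemma derivable_sum (I : Type) (r : seq I) (f : I -> R -> R) (l : I -> R) t :
  (forall i, derivable_pt_lim (f i) t (l i)) ->
  derivable_pt_lim (fun s => \big[Rplus/0]_(i <- r) f i s) t (\big[Rplus/0]_(i <- r) l i).
Proof.
move=> H; elim: r => [|i r IH].
  have -> : (fun s => \big[Rplus/0]_(i <- [::]) f i s) = (fun=> 0).
    by apply: functional_extensionality => s; rewrite big_nil.
  by rewrite big_nil; exact: derivable_pt_lim_const.
have -> : (fun s => \big[Rplus/0]_(i <- i :: r) f i s) =
    (fun s => f i s + \big[Rplus/0]_(i <- r) f i s).
  by apply: functional_extensionality => s; rewrite big_cons.
by rewrite big_cons; apply: derivable_pt_lim_plus.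
Qed.

Lemma derivable_dot n (u : R -> vec n) v t :
  (forall i, derivable_pt_lim (fun s => u s i) t (v i)) ->
  derivable_pt_lim (fun s => dot (u s) (u s)) t (2 * dot (u t) v).
Proof.
move=> H; rewrite /dot big_distrr /=; apply: derivable_sum => i.
rewrite (_ : 2 * _ = v i * u t i + u t i * v i); last lra.
exact: derivable_pt_lim_mult.
Qed.

(** * Gradient trajectories *)

Lemma polyfun_right_continuous0 n (p : vec n -> R) (w : R -> vec n) : polyfun p ->
  (forall i, right_continuous0 (fun s => w s i)) -> right_continuous0 (fun s => p (w s)).
Proof.
move=> pp H; elim: pp => [c|i|a b _ Ha _ Hb|a b _ Ha _ Hb].
- by apply: continuity_pt_const.
- exact: H.
- exact: (continuity_pt_plus (fun s => a (w (Rabs s)))).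
- exact: (continuity_pt_mult (fun s => a (w (Rabs s)))).
Qed.

Lemma polyfun_normsq n : polyfun (fun x : vec n => dot x x).
Proof. by apply: (polyfun_dot id id) => i; exact: polyfun_var. Qed.

Lemma polymap_lipschitz n (g : vec n -> vec n) rho : (forall i, polyfun (fun x => g x i)) ->
  exists L, 0 <= L /\ forall i x y, nrm1 x <= rho -> nrm1 y <= rho ->
    Rabs (g y i - g x i) <= L * nrm1 (vsub y x).
Proof.
move=> pg; have H i := polyfun_lipschitz _ rho (pg i).
pose l i := proj1_sig (constructive_indefinite_description _ (H i)).
have lP i := proj2_sig (constructive_indefinite_description _ (H i)).
have l0 i : 0 <= l i by case: (lP i).
exists (\big[Rplus/0]_(i < n) l i); split; first by apply: Rsum_ge0.
move=> i x y Hx Hy; apply: Rle_trans ((lP i).2 x y Hx Hy) _.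
by apply: Rmult_le_compat_r; [exact: nrm1_ge0|exact: (Rsum_term n l i)].
Qed.

Section GradientFlow.
Context {n m : nat} (phi : vec n -> R) (g : vec n -> vec n) (m1 : (1 <= m)%N)
  (Hphi : is_homog_poly n m phi) (phi_ge0 : forall x, 0 <= phi x) (Hg : is_gradient phi g).

Let pphi : polyfun phi := homog_polyfun m phi Hphi.
Let pg : forall i, polyfun (fun x => g x i) := (gradient_polyfun phi g pphi Hg).1.
Let Q : quadratic_remainder phi g := (gradient_polyfun phi g pphi Hg).2.1.
Let C : chain_rule phi g := (gradient_polyfun phi g pphi Hg).2.2.
Let Euler x : dot (g x) x = INR m * phi x := Euler_identity m phi g x m1 Hphi C.

Let INRm : 1 <= INR m.
Proof. by rewrite -[1]/(INR 1); apply: le_INR; apply/leP. Qed.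

Definition solution (u : R -> vec n) :=
  (forall i t, 0 < t -> derivable_pt_lim (fun s => u s i) t (- g (u t) i)) /\
  (forall i, right_continuous0 (fun s => u s i)).

Lemma solution_norm u s t : solution u -> 0 <= s <= t -> dot (u t) (u t) <= dot (u s) (u s).
Proof.
move=> [D rc] st; apply: (nonincreasing_of_derivative (fun t => dot (u t) (u t)) (t + 1)) => //; try lra.
  (* By Euler's identity the derivative of the squared norm is -2m phi, which is not positive. *)
  move=> r r0; exists (2 * dot (u r) (fun i => -1 * g (u r) i)); split.
    rewrite dotZr dotC Euler; have := phi_ge0 (u r); nra.
  apply: derivable_dot => i; rewrite (_ : -1 * _ = - g (u r) i); last lra.
  by apply: D; lra.
exact: (polyfun_right_continuous0 n _ u (polyfun_normsq n)).
Qed.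

Lemma solution_phi_derivative u t : solution u -> 0 < t ->
  derivable_pt_lim (fun s => phi (u s)) t (- dot (g (u t)) (g (u t))).
Proof.
move=> [D rc] t0; have := C u (fun i => -1 * g (u t) i) t.
rewrite dotZr (_ : -1 * _ = - dot (g (u t)) (g (u t))); last lra.
apply=> i; rewrite (_ : -1 * _ = - g (u t) i); last lra.
exact: D.
Qed.

Lemma solution_phi u s t : solution u -> 0 <= s <= t -> phi (u t) <= phi (u s).
Proof.
move=> su st; apply: (nonincreasing_of_derivative (fun t => phi (u t)) (t + 1)) => //; try lra.
  move=> r r0; exists (- dot (g (u r)) (g (u r))); split; last by apply: solution_phi_derivative; lra || auto.
  by have := dot_ge0 (g (u r)); lra.
by apply: (polyfun_right_continuous0 n _ u pphi); case: su.
Qed.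

Lemma solution_ball u rho t : solution u -> dot (u 0) (u 0) <= rho -> 0 <= t ->
  nrm1 (u t) <= INR n * sqrt rho.
Proof.
move=> su H t0; apply: Rle_trans (nrm1_le_sqrt _) _.
apply: Rmult_le_compat_l; first exact: pos_INR.
by apply: sqrt_le_1_alt; apply: Rle_trans H; apply: solution_norm; lra || auto.
Qed.

Lemma solution_stability rho : exists K, 0 <= K /\ forall u v, solution u -> solution v ->
  dot (u 0) (u 0) <= rho -> dot (v 0) (v 0) <= rho -> forall t, 0 <= t ->
  let D := fun t => dot (vsub (u t) (v t)) (vsub (u t) (v t)) in
  D t <= D 0 * exp (K * t) /\ D 0 <= D t * exp (K * t).
Proof.
have [L [L0 HL]] := polymap_lipschitz n g (INR n * sqrt rho) pg.
exists (2 * L * (INR n * INR n)); split.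
  by have := pos_INR n; nra.
move=> u v su sv ur vr t t0 D; apply: Gronwall => //.
- by have := pos_INR n; nra.
- apply: (polyfun_right_continuous0 n _ (fun s => vsub (u s) (v s)) (polyfun_normsq n)) => i.
  apply: (continuity_pt_minus (fun s => u (Rabs s) i) (fun s => v (Rabs s) i)).
    exact: (su.2 i).
  exact: (sv.2 i).
move=> s s0; set w := vsub (u s) (v s).
exists (2 * dot w (fun i => -1 * vsub (g (u s)) (g (v s)) i)); split; last first.
  apply: (derivable_dot n (fun s => vsub (u s) (v s))) => i.
  rewrite (_ : -1 * _ = - g (u s) i - - g (v s) i); last by rewrite /vsub; lra.
  by apply: derivable_pt_lim_minus; [case: su => H _|case: sv => H _]; exact: H.
have h : Rabs (dot (vsub (g (u s)) (g (v s))) w) <= L * nrm1 w * nrm1 w.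
  apply: dot_le_nrm1 => i; apply: HL; apply: solution_ball => //; lra.
have h2 := nrm1_le_sqrt w.
have h3 := sqrt_sqrt (dot w w) (dot_ge0 w).
rewrite dotZr dotC -Rmult_assoc Rabs_mult (_ : Rabs (2 * -1) = 2); last first.
  by rewrite Rabs_left; lra.
have h4 : nrm1 w * nrm1 w <= INR n * INR n * dot w w.
  rewrite -h3 (_ : _ * (sqrt _ * _) = (INR n * sqrt (dot w w)) * (INR n * sqrt (dot w w))); last lra.
  by apply: Rmult_le_compat => //; exact: nrm1_ge0.
rewrite /D -/w; nra.
Qed.

(** A zero of phi minimizes it on the line through [z] in the direction [g z], and the derivative
    along that line is the squared norm of [g z]. *)
Lemma gradient_zero z : phi z = 0 -> g z = fun=> 0.
Proof.
move=> pz.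
have H : derivable_pt_lim (fun s => phi (fun i => z i + s * g z i)) 0 (dot (g z) (g z)).
  have := C (fun s i => z i + s * g z i) (g z) 0.
  have -> : (fun i => z i + 0 * g z i) = z by apply: functional_extensionality => i; lra.
  apply=> i; rewrite [X in derivable_pt_lim _ _ X](_ : g z i = 0 + (1 * g z i + 0 * 0)); last lra.
  apply: derivable_pt_lim_plus; first exact: derivable_pt_lim_const.
  apply: (derivable_pt_lim_mult id (fun=> g z i)); last exact: derivable_pt_lim_const.
  exact: derivable_pt_lim_id.
pose pr : derivable_pt (fun s => phi (fun i => z i + s * g z i)) 0 := exist _ _ H.
have E : dot (g z) (g z) = 0.
  rewrite -(derive_pt_eq_0 _ _ _ pr H); apply: (deriv_minimum _ (-1) 1); try lra.
  move=> s _ _; have -> : (fun i => z i + 0 * g z i) = z by apply: functional_extensionality => i; lra.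
  by rewrite pz.
apply: functional_extensionality => i; have := dot_term (g z) i; rewrite E; nra.
Qed.

Lemma gradient_pos x : 0 < phi x -> 0 < dot (g x) (g x).
Proof.
move=> px; case: (dot_ge0 (g x)) => // E; exfalso.
have := dot_le (g x) x; rewrite -E sqrt_0 Euler.
have := Rle_abs (INR m * phi x); nra.
Qed.

Lemma solution_const z : phi z = 0 -> solution (fun=> z).
Proof.
move=> pz; split=> [i t _|i]; last exact: continuity_pt_const.
by rewrite (gradient_zero z pz) Ropp_0; exact: derivable_pt_lim_const.
Qed.

Lemma solution_shift u s : solution u -> 0 <= s -> solution (fun t => u (s + t)).
Proof.
(* At [s = 0] the right continuity is inherited; for [s > 0] it comes from differentiability at
   [s]. *)
move=> [D rc] s0; case: (Req_dec s 0) => [->|sn].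
  have -> : (fun t => u (0 + t)) = u by apply: functional_extensionality => t; rewrite Rplus_0_l.
  by split.
split=> [i t t0|i].
  have := derivable_pt_lim_comp (fun t => s + t) (fun t => u t i) t 1 _ _ (D i (s + t) ltac:(lra)).
  rewrite Rmult_1_r; apply.
  rewrite (_ : 1 = 0 + 1); last lra.
  by apply: derivable_pt_lim_plus; [exact: derivable_pt_lim_const|exact: derivable_pt_lim_id].
apply: (continuity_pt_comp (fun t => s + Rabs t) (fun t => u t i)).
  apply: continuity_pt_plus; first exact: continuity_pt_const.
  exact: Rcontinuity_abs.
apply: derivable_continuous_pt; eexists; apply: D.
by have := Rabs_pos 0; lra.
Qed.

(** A zero reached at time [t] would also carry a constant solution; the backward Gronwall bound
    then forces [u 0 = u t]. *)
Lemma solution_pos u t : solution u -> 0 < phi (u 0) -> 0 <= t -> 0 < phi (u t).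
Proof.
move=> su p0 t0; case: (phi_ge0 (u t)) => // E; exfalso.
have [K [K0 HK]] := solution_stability (dot (u 0) (u 0)).
have [_] := HK u _ su (solution_const (u t) (esym E)) (Rle_refl _)
  (solution_norm u 0 t su ltac:(lra)) t t0.
have -> : dot (vsub (u t) (u t)) (vsub (u t) (u t)) = 0.
  by rewrite /dot big1 // => i _; rewrite /vsub; lra.
rewrite Rmult_0_l => H.
have : u 0 = u t.
  apply: nrm1_eq0; apply: Rle_trans (nrm1_le_sqrt _) _.
  by rewrite sqrt_neg_0 ?Rmult_0_r //; lra.
by move=> e; rewrite e -E in p0; lra.
Qed.

(** As long as phi >= eta, Euler's identity gives eta <= |grad phi| r, so phi drops at rate at least
    kappa = (eta/r)^2; from a value at most [B] it would become negative. *)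
Lemma solution_decay rho eta : 0 < eta -> exists T, 0 <= T /\
  forall u, solution u -> dot (u 0) (u 0) <= rho -> forall t, T <= t -> phi (u t) < eta.
Proof.
move=> e0.
have [B [B0 HB]] := polyfun_bounded phi (INR n * sqrt rho) pphi.
pose r := INR n * sqrt rho + 1.
have r0 : 0 < r by have := pos_INR n; have := sqrt_pos rho; rewrite /r; nra.
pose kappa := (eta / r) * (eta / r).
have k0 : 0 < kappa by apply: Rmult_lt_0_compat; apply: Rdiv_lt_0_compat.
exists (B / kappa + 2).
have Bk : 0 <= B / kappa by apply: Rmult_le_pos => //; apply/Rlt_le/Rinv_0_lt_compat.
split=> [|u su ur]; first lra.
suff H : phi (u (B / kappa + 2)) < eta.
  by move=> t Tt; apply: Rle_lt_trans H; apply: solution_phi; lra || auto.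
apply: Rnot_le_lt => H.
(* Comparison is at time [B / kappa + 1], strictly inside the interval, where the drop is already
   [B + kappa]. *)
have := nonincreasing_of_derivative (fun t => phi (u t) + kappa * t) (B / kappa + 2) _ _
  0 (B / kappa + 1) ltac:(lra) ltac:(lra).
have -> : kappa * (B / kappa + 1) = B + kappa by field; lra.
rewrite Rmult_0_r Rplus_0_r => K.
have ph0 : phi (u 0) <= B.
  by have := HB (u 0) (solution_ball u rho 0 su ur (Rle_refl 0)); have := Rle_abs (phi (u 0)); lra.
suff : phi (u (B / kappa + 1)) + (B + kappa) <= phi (u 0).
  by have := phi_ge0 (u (B / kappa + 1)); lra.
apply: K.
  move=> t tT; exists (- dot (g (u t)) (g (u t)) + (0 * t + kappa * 1)); split; last first.
    apply: derivable_pt_lim_plus; first by apply: solution_phi_derivative; lra || auto.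
    apply: (derivable_pt_lim_mult (fun=> kappa) id); last exact: derivable_pt_lim_id.
    exact: derivable_pt_lim_const.
  have pe : eta <= phi (u t).
    by apply: Rle_trans H _; apply: solution_phi; lra || auto.
  have := dot_le (g (u t)) (u t); rewrite Euler.
  have := Rle_abs (INR m * phi (u t)).
  have := solution_ball u rho t su ur ltac:(lra).
  set a := sqrt (dot (g (u t)) (g (u t))) => h1 h2 h3.
  have a0 : 0 <= a by exact: sqrt_pos.
  have h4 : eta <= a * r.
    have : a * nrm1 (u t) <= a * r by apply: Rmult_le_compat_l; rewrite /r; lra.
    have : eta <= INR m * phi (u t) by nra.
    lra.
  have h5 : eta / r <= a.
    by apply: (Rmult_le_reg_r r) => //; rewrite (_ : eta / r * r = eta) //; field; lra.
  have h6 : kappa <= a * a.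
    have : 0 < eta / r by apply: Rdiv_lt_0_compat.
    by rewrite /kappa => ?; apply: Rmult_le_compat; lra.
  by move: h6; rewrite /a sqrt_sqrt; [lra|exact: dot_ge0].
apply: (continuity_pt_plus (fun s => phi (u (Rabs s))) (fun s => kappa * Rabs s)).
  by apply: (polyfun_right_continuous0 n _ u pphi); case: su.
apply: (continuity_pt_mult (fun=> kappa) Rabs); first exact: continuity_pt_const.
exact: Rcontinuity_abs.
Qed.

Lemma solution_continuous u t eps : solution u -> 0 <= t -> 0 < eps ->
  exists d, 0 < d /\ forall s, 0 <= s -> Rabs (s - t) < d -> nrm1 (vsub (u s) (u t)) < eps.
Proof.
move=> su t0 e0.
have n0 : 0 < INR n + 1 by have := pos_INR n; lra.
have H i : exists d, 0 < d /\ forall r, 0 < r <= d -> forall s, 0 <= s -> Rabs (s - t) < r ->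
    Rabs (u s i - u t i) < eps / (INR n + 1).
  have en : 0 < eps / (INR n + 1) by apply: Rdiv_lt_0_compat.
  case: t0 => [tp|<-].
    have ct : continuity_pt (fun s => u s i) t.
      by apply: derivable_continuous_pt; eexists; case: su => D _; apply: D.
    have [d [d0 Hd]] := ct _ en; exists d; split=> // r rd s s0 st.
    case: (Req_dec s t) => [->|ne]; first by rewrite Rminus_diag Rabs_R0.
    apply: (Hd s); split; first by split=> //; apply: nesym.
    by rewrite /= /Rdist; lra.
  have [_ /(_ i)/right_continuous0P rc] := su.
  have [d [d0 Hd]] := rc _ en; exists d; split=> // r rd s s0.
  by rewrite Rminus_0_r Rabs_pos_eq // => st; apply: Hd; lra.
have [d [d0 Hd]] := ord_uniform_pos n _ H; exists d; split=> // s s0 st.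
have : nrm1 (vsub (u s) (u t)) <= INR n * (eps / (INR n + 1)).
  rewrite -Rsum_const; apply: Rsum_le => i _; apply: Rlt_le.
  by apply: (Hd d) => //; lra.
move/Rle_lt_trans; apply.
apply: (Rmult_lt_reg_r (INR n + 1)) => //; field_simplify; last lra.
by have := pos_INR n; nra.
Qed.

Lemma solution_local_speed u s : (1 <= n)%N -> solution u -> 0 < s -> 0 < phi (u s) ->
  let a := sqrt (dot (g (u s)) (g (u s))) in
  exists d, 0 < d /\ forall t, Rabs (t - s) < d ->
    a * nrm1 (vsub (u t) (u s)) <= 4 * INR n * Rabs (phi (u t) - phi (u s)).
Proof.
move=> n1 su s0 ps a.
have a0 : 0 < a by apply: sqrt_lt_R0; exact: gradient_pos.
have aa : a * a = dot (g (u s)) (g (u s)) by apply: sqrt_sqrt; exact: dot_ge0.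
have H i : exists d, 0 < d /\ forall r, 0 < r <= d -> forall t, Rabs (t - s) < r ->
    (* For [t] near [s] each coordinate moves by at most 2a|t - s| while phi changes by at least
       a^2|t - s|/2; this yields the constant [4 * INR n]. *)
    Rabs (u t i - u s i) <= 2 * a * Rabs (t - s).
  have [D _] := su; have [d [d0 Hd]] := derivable_local _ _ _ (D i s s0) a a0.
  exists d; split=> // r rd t tr; have := Hd t ltac:(lra).
  have := Rabs_triang (u t i - u s i - - g (u s) i * (t - s)) (- g (u s) i * (t - s)).
  rewrite (_ : _ - _ - _ + _ = u t i - u s i); last lra.
  rewrite Rabs_mult Rabs_Ropp; have := coord_le_sqrt (g (u s)) i; rewrite -/a.
  by have := Rabs_pos (t - s); nra.
have [d [d0 Hd]] := ord_uniform_pos n _ H.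
have [c [c0 Hc]] := derivable_local _ _ _ (solution_phi_derivative u s su s0) (a * a / 2) ltac:(nra).
exists (Rmin d c); split; first exact: Rmin_pos.
move=> t tm; have := Rmin_l d c; have := Rmin_r d c => mc md.
have h1 : nrm1 (vsub (u t) (u s)) <= INR n * (2 * a * Rabs (t - s)).
  by rewrite -Rsum_const; apply: Rsum_le => i _; apply: (Hd d) => //; lra.
have := Hc t ltac:(lra); rewrite -aa => h2.
have := Rabs_triang (- (phi (u t) - phi (u s) - - (a * a) * (t - s))) (phi (u t) - phi (u s)).
rewrite Rabs_Ropp (_ : - _ + _ = - (a * a) * (t - s)); last lra.
rewrite Rabs_mult Rabs_Ropp (Rabs_pos_eq (a * a)); last nra.
move=> h3; have nn := pos_INR n.
have h4 : a * a / 2 * Rabs (t - s) <= Rabs (phi (u t) - phi (u s)) by lra.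
apply: Rle_trans (Rmult_le_compat_l a _ _ (Rlt_le _ _ a0) h1) _.
have := Rmult_le_compat_l (4 * INR n) _ _ ltac:(lra) h4; lra.
Qed.

Lemma solution_short rho eps : (1 <= n)%N -> 0 < eps -> exists delta, 0 < delta /\
  forall u, solution u -> dot (u 0) (u 0) <= rho -> phi (u 0) < delta ->
  forall t, 0 <= t -> nrm1 (vsub (u t) (u 0)) <= eps.
Proof.
move=> n1 e0.
have n0 : 1 <= INR n by rewrite -[1]/(INR 1); apply: le_INR; apply/leP.
have [d [V [B [d0 [VB VL]]]]] := talweg n phi g rho pphi pg Q gradient_pos.
(* The factor [4 * INR n] of [solution_local_speed] times the factor 2 of [talweg]. *)
pose M := 8 * INR n; have M0 : 0 < M by rewrite /M; lra.
(* [V] is monotone and bounded in variation, hence Cauchy at 0: [c2] nearly attains the supremum [l]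
   of its total drop from [d / 2]. *)
have [c2 [c2d Hc2]] : exists c2, 0 < c2 < d /\ forall c c', 0 < c -> c <= c' -> c' < c2 ->
    0 <= V c' - V c <= eps / M.
  have [l [ub lub]] : {l | is_lub (fun r => exists c, 0 < c < d / 2 /\ r = V (d / 2) - V c) l}.
    apply: completeness; last by eexists; exists (d / 4); split; [lra|reflexivity].
    by exists B => r [c [cd ->]]; have := VB c (d / 2) ltac:(lra) ltac:(lra) ltac:(lra); lra.
  have eM : 0 < eps / M by apply: Rdiv_lt_0_compat.
  have [c2 [c2d Hc2]] : exists c2, 0 < c2 < d / 2 /\ l - eps / M < V (d / 2) - V c2.
    apply: NNPP => H; have : l <= l - eps / M; last lra.
    apply: lub => r [c [cd ->]]; apply: Rnot_lt_le => K; apply: H; by exists c.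
  exists c2; split=> [|c c' c0 cc cc2]; first lra.
  have lc := ub (V (d / 2) - V c) ltac:(by exists c; split; [lra|reflexivity]).
  have h2 := VB c' c2 ltac:(lra) cc2 ltac:(lra).
  case: cc => [cc|<-]; last lra.
  by have := VB c c' c0 cc ltac:(lra); lra.
exists c2; split=> [|u su ur pu t t0]; first lra.
have KM : M * (eps / M) = eps by field; lra.
case: (phi_ge0 (u 0)) => [pu0|pz]; last first.
  have [K [K0 HK]] := solution_stability (dot (u 0) (u 0)).
  have [] := HK u _ su (solution_const (u 0) (esym pz)) (Rle_refl _) (Rle_refl _) t t0.
  have -> : dot (vsub (u 0) (u 0)) (vsub (u 0) (u 0)) = 0.
    by rewrite /dot big1 // => i _; rewrite /vsub; lra.
  rewrite Rmult_0_l => H _; apply: Rle_trans (nrm1_le_sqrt _) _.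
  by rewrite sqrt_neg_0 //; lra.
have pos s : 0 <= s -> 0 < phi (u s) < c2.
  move=> s0; split; first exact: solution_pos.
  by apply: Rle_lt_trans pu; apply: solution_phi; lra || auto.
(* Transitive by the triangle inequality, as the right-hand sides telescope; [chain] makes the local
   estimates global. *)
pose W s t := nrm1 (vsub (u t) (u s)) <= M * (V (phi (u s)) - V (phi (u t))).
have loc s : 0 < s -> exists e, 0 < e /\ forall t, 0 < t -> Rabs (t - s) < e ->
    nrm1 (vsub (u t) (u s)) <= M * Rabs (V (phi (u t)) - V (phi (u s))).
  move=> s0; have ps := pos s ltac:(lra).
  have [e1 [e10 H1]] := solution_local_speed u s n1 su s0 ps.1.
  have [e2 [e20 H2]] := VL (phi (u s)) ltac:(lra).
  have ct : continuity_pt (fun t => phi (u t)) s.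
    by apply: derivable_continuous_pt; eexists; exact: solution_phi_derivative.
  have [e3 [e30 H3]] := ct e2 e20.
  exists (Rmin e1 e3); split; first exact: Rmin_pos.
  move=> r r0 rs; have := Rmin_l e1 e3; have := Rmin_r e1 e3 => h3 h1.
  have pr := pos r ltac:(lra).
  have near : Rabs (phi (u r) - phi (u s)) < e2.
    case: (Req_dec r s) => [->|ne]; first by rewrite Rminus_diag Rabs_R0.
    apply: (H3 r); split; first by split=> //; apply: nesym.
    by rewrite /= /Rdist; lra.
  have us : dot (u s) (u s) <= rho.
    by apply: Rle_trans ur; apply: solution_norm; lra || auto.
  have := H2 (phi (u r)) ltac:(lra) near (u s) erefl us.
  have := H1 r ltac:(lra).
  have := sqrt_lt_R0 _ (gradient_pos _ ps.1).
  set a := sqrt _; set X := nrm1 _; set Y := Rabs (phi _ - _); set Z := Rabs (V _ - _).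
  (* Both estimates are taken at the same point [u s], so the gradient norm [a] cancels. *)
  move=> a0 h4 h5; apply: (Rmult_le_reg_l a) => //; rewrite /M; nra.
have chainW s : 0 < s -> s < t -> W s t.
  move=> s0 st; apply: chain => //.
  - move=> x y z sx xy yz zt; rewrite /W => h1 h2.
    by have := nrm1_sub_triang (u z) (u y) (u x); lra.
  - move=> x sx; have [e [e00 He]] := loc x ltac:(lra).
    exists e; split=> // y xy; rewrite /W; apply: Rle_trans (He y _ _) _; [lra|by rewrite Rabs_pos_eq; lra|].
    apply/Req_le; congr (_ * _); rewrite Rabs_minus_sym Rabs_pos_eq //.
    have py := pos y ltac:(lra); have px := pos x ltac:(lra).
    by apply: (Hc2 _ _ py.1 _ px.2).1; apply: solution_phi; lra || auto.
  - move=> x sx; have [e [e00 He]] := loc x ltac:(lra).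
    exists (Rmin e x); split; first by apply: Rmin_pos; lra.
    move=> y yx; have := Rmin_l e x; have := Rmin_r e x => h1 h2.
    rewrite /W nrm1_subC; apply: Rle_trans (He y _ _) _; [lra|by rewrite Rabs_left; lra|].
    apply/Req_le; congr (_ * _); rewrite Rabs_pos_eq //.
    have py := pos y ltac:(lra); have px := pos x ltac:(lra).
    by apply: (Hc2 _ _ px.1 _ py.2).1; apply: solution_phi; lra || auto.
case: (Req_dec t 0) => [->|tn].
  by rewrite /nrm1 big1 => [|i _]; [lra|rewrite /vsub Rminus_diag Rabs_R0].
(* [chainW] starts at positive times only; continuity at 0 extends its bound to the initial
   point. *)
apply: Rnot_lt_le => H.
have [e [e00 He]] := solution_continuous u 0 (nrm1 (vsub (u t) (u 0)) - eps) su (Rle_refl 0) ltac:(lra).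
have := Rmin_l (e / 2) (t / 2); have := Rmin_r (e / 2) (t / 2).
have : 0 < Rmin (e / 2) (t / 2) by apply: Rmin_pos; lra.
set s := Rmin _ _ => s0 s1 s2.
have := He s ltac:(lra); rewrite Rminus_0_r Rabs_pos_eq; last lra.
have := nrm1_sub_triang (u t) (u s) (u 0).
have ps := pos s ltac:(lra); have pt := pos t t0.
have := Hc2 _ _ pt.1 (solution_phi u s t su ltac:(lra)) ps.2.
have := chainW s s0 ltac:(lra); rewrite /W.
set X := V _ - _ => h1 h2; have : M * X <= M * (eps / M) by apply: Rmult_le_compat_l; lra.
lra.
Qed.

Lemma solution_Cauchy rho eps : (1 <= n)%N -> 0 < eps -> exists T, 0 <= T /\
  forall u, solution u -> dot (u 0) (u 0) <= rho -> forall s t, T <= s -> T <= t ->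
  nrm1 (vsub (u t) (u s)) <= eps.
Proof.
move=> n1 e0; have [delta [de0 H]] := solution_short rho (eps / 2) n1 ltac:(lra).
have [T [T0 HT]] := solution_decay rho delta de0.
exists T; split=> // u su ur s t Ts Tt.
(* From time [T] on the trajectory is one that starts at a value of phi below [delta]. *)
have H' r : T <= r -> nrm1 (vsub (u r) (u T)) <= eps / 2.
  move=> Tr; have := H (fun r => u (T + r)) (solution_shift u T su T0); rewrite Rplus_0_r.
  move=> /(_ _ _ (r - T)); rewrite (_ : T + (r - T) = r); last lra.
  apply; last lra; last by apply: HT => //; lra.
  by apply: Rle_trans ur; apply: solution_norm; lra || auto.
have := nrm1_sub_triang (u t) (u T) (u s); rewrite (nrm1_subC (u T)).
by have := H' s Ts; have := H' t Tt; lra.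
Qed.

Lemma solution_lipschitz rho T : exists L, 0 <= L /\ forall u v, solution u -> solution v ->
  dot (u 0) (u 0) <= rho -> dot (v 0) (v 0) <= rho -> forall t, 0 <= t <= T ->
  nrm1 (vsub (u t) (v t)) <= L * nrm1 (vsub (u 0) (v 0)).
Proof.
have [K [K0 HK]] := solution_stability rho.
exists (INR n * sqrt (exp (K * T))); split.
  by apply: Rmult_le_pos; [exact: pos_INR|exact: sqrt_pos].
move=> u v su sv ur vr t tT; have [H _] := HK u v su sv ur vr t tT.1.
apply: Rle_trans (nrm1_le_sqrt _) _; rewrite Rmult_assoc.
apply: Rmult_le_compat_l; first exact: pos_INR.
have w0 := nrm1_ge0 (vsub (u 0) (v 0)).
rewrite -[X in _ <= _ * X](sqrt_Rsqr _ w0) -sqrt_mult_alt; last exact/Rlt_le/exp_pos.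
apply: sqrt_le_1_alt; apply: Rle_trans H _; rewrite Rmult_comm.
apply: Rmult_le_compat; [exact/Rlt_le/exp_pos|exact: dot_ge0| |exact: dot_le_nrm1_sqr].
case: (Req_dec t T) => [->|ne]; first lra.
case: K0 => [K0|<-]; last by rewrite !Rmult_0_l; lra.
by apply/Rlt_le/exp_increasing/Rmult_lt_compat_l => //; lra.
Qed.

End GradientFlow.

(** * The retraction *)

(** The limit [z] is fixed before [eps] and [T], so a Cauchy time common to many trajectories serves
    unchanged as a common convergence time. *)
Lemma cluster_of_Cauchy n (u : R -> vec n) K : (forall t, 0 <= t -> nrm1 (u t) <= K) ->
  exists z, forall eps T, (forall s t, T <= s -> T <= t -> nrm1 (vsub (u t) (u s)) <= eps) ->
    forall t, T <= t -> nrm1 (vsub (u t) z) <= eps.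
Proof.
move=> bu; have [z Hz] := bounded_cluster n (fun k => u (INR k)) K (fun k => bu _ (pos_INR k)).
exists z => eps T H t Tt; apply: Rnot_lt_le => lt.
have [N HN] : exists N, T <= INR N.
  have [N HN] := INR_unbounded T; by exists N; lra.
have [k [/leP/le_INR Nk Hk]] := Hz (nrm1 (vsub (u t) z) - eps) ltac:(lra) N.
have := H (INR k) t ltac:(lra) Tt; have := nrm1_sub_triang (u t) (u (INR k)) z; lra.
Qed.

Lemma nrm1_near n eta : 0 < eta -> exists d, 0 < d /\
  forall x x' : vec n, vnorm (vsub x' x) < d -> nrm1 (vsub x' x) < eta.
Proof.
move=> e0; have n0 : 0 < INR n + 1 by have := pos_INR n; lra.
exists (eta / (INR n + 1)); split; first exact: Rdiv_lt_0_compat.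
move=> x x' H; apply: Rle_lt_trans (nrm1_le_vnorm _) _.
have : (INR n + 1) * vnorm (vsub x' x) < eta.
  have := Rmult_lt_compat_l _ _ _ n0 H.
  by have -> : (INR n + 1) * (eta / (INR n + 1)) = eta by field; lra.
by have := sqrt_pos (\big[Rplus/0]_(i < n) (vsub x' x i ^ 2)); rewrite -/(vnorm _); nra.
Qed.

Lemma time_change_continuous t eta : 0 <= t < 1 -> 0 < eta -> exists d, 0 < d /\
  forall t', 0 <= t' -> Rabs (t' - t) < d -> t' < 1 /\ Rabs (t' / (1 - t') - t / (1 - t)) < eta.
Proof.
(* Within (1 - t)/2 of [t] one has (1 - t')(1 - t) >= q, the denominator of the difference of the
   two times. *)
move=> t01 e0; pose q := (1 - t) * (1 - t) / 2.
have q0 : 0 < q by rewrite /q; nra.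
exists (Rmin ((1 - t) / 2) (eta * q)); split; first by apply: Rmin_pos; nra.
move=> t' t0 H; have := Rmin_l ((1 - t) / 2) (eta * q); have := Rmin_r ((1 - t) / 2) (eta * q).
move=> h1 h2; have h3 := Rle_abs (t' - t).
split; first lra.
have -> : t' / (1 - t') - t / (1 - t) = (t' - t) * / ((1 - t') * (1 - t)) by field; lra.
have p : 0 < (1 - t') * (1 - t) by apply: Rmult_lt_0_compat; lra.
rewrite Rabs_mult (Rabs_pos_eq (/ _)); last exact/Rlt_le/Rinv_0_lt_compat.
apply: (Rmult_lt_reg_r ((1 - t') * (1 - t))) => //.
rewrite Rmult_assoc Rinv_l ?Rmult_1_r; last lra.
have := Rmult_le_compat_r (1 - t) ((1 - t) / 2) (1 - t') ltac:(lra) ltac:(lra) => h4.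
apply: Rlt_le_trans H _; apply: Rle_trans h1 _; apply: Rmult_le_compat_l; first lra.
rewrite /q; lra.
Qed.

Theorem theorem7 (n m : nat) (phi : vec n -> R) (g : vec n -> vec n)
  (F : R -> vec n -> vec n) :
  (1 <= n)%nat -> (2 <= m)%nat ->
  is_homog_poly n m phi ->
  (forall x, 0 <= phi x) ->
  is_gradient phi g ->
  is_neg_grad_flow g F ->
  exists Finf : vec n -> vec n,
    (forall x, tends_to_infty (fun s => F s x) (Finf x)) /\
    continuous_on_I_Rn (Uhom F Finf) /\
    (forall x, Uhom F Finf 0 x = x) /\
    (forall t y, 0 <= t <= 1 -> phi y = 0 -> Uhom F Finf t y = y) /\
    (forall x, phi (Uhom F Finf 1 x) = 0) /\
    (forall y, phi y = 0 -> exists x, Uhom F Finf 1 x = y).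
Proof.
move=> n1 m2 Hphi phi0 Hg [F0 [FD Frc]]; have m1 := ltnW m2.
have sF x : solution g (fun s => F s x).
  split=> [i t t0|i]; first exact: FD.
  by apply/right_continuous0P => eps e0; rewrite F0; exact: Frc.
have bF x t := solution_ball phi g m1 Hphi phi0 Hg _ (dot (F 0 x) (F 0 x)) t (sF x) (Rle_refl _).
have HC rho eps := solution_Cauchy phi g m1 Hphi phi0 Hg rho eps n1.
have lim x := cluster_of_Cauchy n (fun s => F s x) _ (bF x).
pose Finf x := proj1_sig (constructive_indefinite_description _ (lim x)).
have FinfP x := proj2_sig (constructive_indefinite_description _ (lim x)).
have unif rho eps : 0 < eps -> exists T, 0 <= T /\ forall x, dot x x <= rho ->
    forall t, T <= t -> nrm1 (vsub (F t x) (Finf x)) <= eps.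
  move=> e0; have [T [T0 HT]] := HC rho eps e0; exists T; split=> // x xr.
  by apply: FinfP; apply: HT => //; rewrite F0.
have fixed y t : phi y = 0 -> 0 <= t -> F t y = y.
  move=> py t0; apply: nrm1_eq0; apply: Rnot_lt_le => H.
  (* A start with phi = 0 is below every threshold, so its trajectory is shorter than any positive
     bound. *)
  have [d [d0 Hd]] := solution_short phi g m1 Hphi phi0 Hg (dot y y) (nrm1 (vsub (F t y) y) / 2)
    n1 ltac:(lra).
  by have := Hd _ (sF y); rewrite F0 py => /(_ (Rle_refl _) d0 t t0); lra.
have fixed_inf y : phi y = 0 -> Finf y = y.
  move=> py; apply: nrm1_eq0; rewrite nrm1_subC; apply: Rnot_lt_le => H.
  have [T [T0 HT]] := unif (dot y y) (nrm1 (vsub y (Finf y)) / 2) ltac:(lra).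
  by have := HT y (Rle_refl _) T (Rle_refl _); rewrite fixed //; lra.
have U1 x : Uhom F Finf 1 x = Finf x by rewrite /Uhom; case: Rlt_dec => // h; exfalso; lra.
have zero x : phi (Finf x) = 0.
  case: (phi0 (Finf x)) => // p; exfalso.
  have [d [d0 Hd]] := polyfun_continuous n phi (Finf x) (phi (Finf x) / 2)
    (homog_polyfun m phi Hphi) ltac:(lra).
  have [T [T0 HT]] := unif (dot x x) (d / 2) ltac:(lra).
  have [S [S0 HS]] := solution_decay phi g m1 Hphi phi0 Hg (dot x x) (phi (Finf x) / 2) ltac:(lra).
  have := HS _ (sF x); rewrite F0 => /(_ (Rle_refl _) (Rmax S T) (Rmax_l _ _)).
  have := HT x (Rle_refl _) (Rmax S T) (Rmax_r _ _) => h1.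
  have := Hd (F (Rmax S T) x) ltac:(lra).
  have := Rle_abs (- (phi (F (Rmax S T) x) - phi (Finf x))); rewrite Rabs_Ropp; lra.
have near (x : vec n) : exists d, 0 < d /\ forall x', vnorm (vsub x' x) < d ->
    dot x' x' <= (nrm1 x + 1) * (nrm1 x + 1).
  have [d [d0 Hd]] := nrm1_near n 1 ltac:(lra); exists d; split=> // x' xx.
  apply: Rle_trans (dot_le_nrm1_sqr _) _.
  have : nrm1 x' <= nrm1 x + 1.
    have -> : x' = (fun i => vsub x' x i + x i).
      by apply: functional_extensionality => i; rewrite /vsub; lra.
    by have := nrm1_triang (vsub x' x) x; have := Hd _ _ xx; lra.
  by move=> h; apply: Rmult_le_compat => //; exact: nrm1_ge0.
have dep x T eps : 0 < eps -> exists d, 0 < d /\ forall x', vnorm (vsub x' x) < d ->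
    forall s, 0 <= s <= T -> nrm1 (vsub (F s x') (F s x)) < eps.
  move=> e0; have [d [d0 Hd]] := near x; set rho := _ * _ in Hd.
  have [L [L0 HL]] := solution_lipschitz phi g m1 Hphi phi0 Hg rho T.
  have [c [c0 Hc]] := nrm1_near n (eps / (L + 1)) ltac:(apply: Rdiv_lt_0_compat; lra).
  exists (Rmin d c); split; first exact: Rmin_pos.
  move=> x' xx s sT; have := Rmin_l d c; have := Rmin_r d c => h1 h2.
  have xr : dot x x <= rho.
    apply: Hd; rewrite vnormE (_ : dot _ _ = 0) ?sqrt_0 //.
    by rewrite /dot big1 // => i _; rewrite /vsub; lra.
  have := HL _ _ (sF x') (sF x); rewrite !F0 => /(_ (Hd x' ltac:(lra)) xr s sT) h3.
  have := Rmult_lt_compat_l (L + 1) _ _ ltac:(lra) (Hc x x' ltac:(lra)).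
  have -> : (L + 1) * (eps / (L + 1)) = eps by field; lra.
  by have := nrm1_ge0 (vsub x' x); nra.
exists Finf; split; [|split; [|split; [|split; [|split]]]].
- move=> x eps e0; have [T [T0 HT]] := unif (dot x x) (eps / 2) ltac:(lra).
  exists T => s Ts; apply: Rle_lt_trans (vnorm_le_nrm1 _) _.
  by have := HT x (Rle_refl _) s Ts; lra.
- move=> t x t01 eps e0.
  suff [d [d0 Hd]] : exists d, 0 < d /\ forall t' x', 0 <= t' <= 1 -> Rabs (t' - t) < d ->
      vnorm (vsub x' x) < d -> nrm1 (vsub (Uhom F Finf t' x') (Uhom F Finf t x)) < eps.
    exists d; split=> // t' x' h1 h2 h3; apply: Rle_lt_trans (vnorm_le_nrm1 _) _; exact: Hd.
  case: (Rlt_dec t 1) => t1.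
    have s0 : 0 <= t / (1 - t) by apply: Rmult_le_pos; [lra|apply/Rlt_le/Rinv_0_lt_compat; lra].
    have [a [a0 Ha]] := solution_continuous g _ (t / (1 - t)) (eps / 2) (sF x) s0 ltac:(lra).
    (* The extra 1 leaves room for the perturbed time, which the bound [Rmin a 1] keeps within 1 of
       the original. *)
    have [b [b0 Hb]] := dep x (t / (1 - t) + 1) (eps / 2) ltac:(lra).
    have [c [c0 Hc]] := time_change_continuous t (Rmin a 1) ltac:(lra) ltac:(apply: Rmin_pos; lra).
    exists (Rmin b c); split; first exact: Rmin_pos.
    move=> t' x' t'01 tt xx; have := Rmin_l b c; have := Rmin_r b c => h1 h2.
    have [t'1 ss] := Hc t' t'01.1 ltac:(lra).
    have := Rmin_l a 1; have := Rmin_r a 1 => h3 h4.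
    have s'0 : 0 <= t' / (1 - t') by apply: Rmult_le_pos; [lra|apply/Rlt_le/Rinv_0_lt_compat; lra].
    rewrite /Uhom; case: (Rlt_dec t' 1) => // h5; case: (Rlt_dec t 1) => // h6.
    apply: Rle_lt_trans (nrm1_sub_triang _ (F (t' / (1 - t')) x) _) _.
    have := Ha (t' / (1 - t')) s'0 ltac:(lra).
    have := Rle_abs (t' / (1 - t') - t / (1 - t)) => h7.
    by have := Hb x' ltac:(lra) (t' / (1 - t')) ltac:(lra); lra.
  have -> : t = 1 by lra.
  have [a [a0 Ha]] := near x; set rho := _ * _ in Ha.
  have [T [T0 HT]] := unif rho (eps / 4) ltac:(lra).
  have [b [b0 Hb]] := dep x T (eps / 4) ltac:(lra).
  have T1 : 0 < / (1 + T) by apply: Rinv_0_lt_compat; lra.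
  (* If 1 - t' < 1/(1 + T), then t'/(1 - t') > T, so [U] at t' is already close to its limit,
     uniformly over the ball. The distance is then split into four parts of size eps/4. *)
  exists (Rmin (Rmin a b) (/ (1 + T))); split; first by do 2 apply: Rmin_pos => //.
  move=> t' x' t'01 tt xx.
  have := Rmin_l (Rmin a b) (/ (1 + T)); have := Rmin_r (Rmin a b) (/ (1 + T)).
  have := Rmin_l a b; have := Rmin_r a b => h1 h2 h3 h4.
  have xr : dot x x <= rho.
    apply: Ha; rewrite vnormE (_ : dot _ _ = 0) ?sqrt_0 //.
    by rewrite /dot big1 // => i _; rewrite /vsub; lra.
  have close : nrm1 (vsub (Uhom F Finf t' x') (Finf x')) <= eps / 4.
    rewrite /Uhom; case: Rlt_dec => t'1; last first.
      by rewrite /nrm1 big1 => [|i _]; [lra|rewrite /vsub Rminus_diag Rabs_R0].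
    apply: HT; first by apply: Ha; lra.
    have h5 : 1 - t' < / (1 + T) by have := Rle_abs (- (t' - 1)); rewrite Rabs_Ropp; lra.
    apply: (Rmult_le_reg_r (1 - t')); first lra.
    rewrite (_ : t' / (1 - t') * (1 - t') = t'); last by field; lra.
    have := Rmult_lt_compat_l (1 + T) _ _ ltac:(lra) h5.
    by rewrite Rinv_r; lra.
  rewrite U1.
  have := nrm1_sub_triang (Uhom F Finf t' x') (Finf x') (Finf x).
  have := nrm1_sub_triang (Finf x') (F T x') (Finf x).
  have := nrm1_sub_triang (F T x') (F T x) (Finf x).
  have := HT x xr T (Rle_refl _); have := HT x' (Ha x' ltac:(lra)) T (Rle_refl _).
  have := Hb x' ltac:(lra) T ltac:(lra).
  by rewrite (nrm1_subC (Finf x') (F T x')); lra.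
- move=> x; rewrite /Uhom; case: Rlt_dec => [h|h]; last by exfalso; lra.
  by rewrite /Rdiv Rmult_0_l F0.
- move=> t y t01 py; rewrite /Uhom; case: Rlt_dec => t1; last exact: fixed_inf.
  apply: fixed => //; apply: Rmult_le_pos; first lra.
  by apply/Rlt_le/Rinv_0_lt_compat; lra.
- by move=> x; rewrite U1.
- by move=> y py; exists y; rewrite U1; exact: fixed_inf.
Qed.
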